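(* Let $\mathbb{K}$ be an arbitrary field, let $U$ and $V$ be finite-dimensional vector spaces over $\mathbb{K}$, and let $\mathcal{S}$ be a $2$-dimensional reduced subspace of $\mathcal{L}(U,V)$. Set $$\mathcal{E}_2:=\left\{\begin{bmatrix} a&b&0\\ 0&a&b\end{bmatrix} : (a,b)\in\mathbb{K}^2\right\}\quad\text{and}\quad \mathcal{E}_3:=\left\{\begin{bmatrix} a&b&0\\ 0&a&b\\ 0&0&a\end{bmatrix} : (a,b)\in\mathbb{K}^2\right\}.$$ Then $\mathcal{S}$ is algebraically reflexive unless one of the following conditions holds: (i) $\dim U=\dim V=2$ and the set of rank $1$ operators of $\mathcal{S}$ is included in a $1$-dimensional linear subspace of $\mathcal{S}$; (ii) $\mathcal{S}$ is represented by $\mathcal{E}_2$ in some bases of $U$ and $V$, and $\#\mathbb{K}=2$; (iii) $\mathcal{S}$ is represented by $\mathcal{E}_3$ in some bases of $U$ and $V$, and $\#\mathbb{K}=2$; (iv) $\mathcal{S}$ is represented by $\mathcal{E}_2^T$ in some bases of $U$ and $V$, and $\#\mathbb{K}=2$. Moreover, in cases (ii), (iii) and (iv), the reflexivity defect of $\mathcal{S}$ equals $1$.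
   Context: $\mathcal{L}(U,V)$ is the space of linear operators from $U$ to $V$. A linear subspace $\mathcal{S}$ of $\mathcal{L}(U,V)$ is reduced when no non-zero vector of $U$ is annihilated by all the operators in $\mathcal{S}$ and the sum of the ranges of the operators in $\mathcal{S}$ equals $V$. The reflexive closure $\mathcal{R}(\mathcal{S})$ is the space of all linear operators $g:U\to V$ such that $g(x)\in\mathcal{S}x:=\{s(x): s\in\mathcal{S}\}$ for all $x\in U$. The space $\mathcal{S}$ is (algebraically) reflexive when $\mathcal{R}(\mathcal{S})=\mathcal{S}$; its reflexivity defect is $\dim\mathcal{R}(\mathcal{S})-\dim\mathcal{S}$. $\mathcal{E}_2^T$ denotes the set of transposes of the matrices of $\mathcal{E}_2$. *)

(* Defs.v *)
From HB Require Import structures.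
From mathcomp Require Import all_boot all_order all_algebra.
From mathcomp Require Import boolp classical_sets functions cardinality.

Set Implicit Arguments.
Unset Strict Implicit.
Unset Printing Implicit Defensive.

Import GRing.Theory.
Local Open Scope ring_scope.

Section OperatorSpaces.
Variables (K : fieldType) (U V : vectType K).
Implicit Types (S R D : {vspace 'Hom(U, V)}) (s g : 'Hom(U, V)).

(* An element of the sum of a possibly infinite family of subspaces belongs to
   the sum of finitely many of them. *)
Definition in_sum_of_ranges S (y : V) : Prop :=
  exists2 r : seq 'Hom(U, V), {subset r <= S} & y \in (\sum_(s <- r) limg s)%VS.

Definition reduced S : Prop :=
  (forall x : U, x != 0 -> ~ (forall s, s \in S -> s x = 0)) /\
  (forall y : V, in_sum_of_ranges S y).

Definition in_reflexive_closure S g : Prop :=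
  forall x : U, exists2 s, s \in S & g x = s x.

(* The operators g such that g x \in S x, for a single vector x. *)
Definition closure_at S (x : U) : {vspace 'Hom(U, V)} :=
  let ev := linfun (fun g : 'Hom(U, V) => g x) in (ev @^-1: (ev @: S))%VS.

Lemma closure_atP S x g :
  g \in closure_at S x <-> exists2 s, s \in S & g x = s x.
Proof.
have ev_lin : linear (fun h : 'Hom(U, V) => h x).
  by move=> a h1 h2; rewrite lfunE /= lfunE.
pose evM := GRing.isLinear.Build _ _ _ _ (fun h : 'Hom(U, V) => h x) ev_lin.
pose evL : {linear 'Hom(U, V) -> V} := HB.pack (fun h : 'Hom(U, V) => h x) evM.
have evE h : linfun (fun h : 'Hom(U, V) => h x) h = h x by exact: (lfunE evL h).
rewrite /closure_at -memv_preim evE; split.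
  by case/memv_imgP => s sS ->; exists s; rewrite ?evE.
by case=> s sS ->; rewrite -evE memv_img.
Qed.

(* R(S) is a linear subspace, as an intersection of subspaces. *)
Lemma reflexive_closure_exists S :
  exists R, forall g, g \in R <-> in_reflexive_closure S g.
Proof.
pose W (xs : seq U) := (\bigcap_(x <- xs) closure_at S x)%VS.
pose P n := `[< exists xs, \dim (W xs) = n >].
have exP : exists n, P n by exists (\dim (W [::])); apply/asboolP; exists [::].
case: (ex_minnP exP) => n /asboolP[xs dimW] minW.
exists (W xs) => g; split=> [gW x | gR].
  apply/closure_atP; have sub : (W (x :: xs) <= W xs)%VS.
    by rewrite /W big_cons capvSr.
  have := eqEdim (W (x :: xs)) (W xs).
  rewrite sub dimW minW; last by apply/asboolP; exists (x :: xs).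
  move=> /eqP eqW; move: gW; rewrite -eqW /W big_cons memv_cap.
  by case/andP.
rewrite /W; elim: xs {dimW} => [|x xs IHxs]; first by rewrite big_nil memvf.
rewrite big_cons memv_cap IHxs andbT; exact/closure_atP.
Qed.

Definition reflexive_closure S : {vspace 'Hom(U, V)} :=
  sval (cid (reflexive_closure_exists S)).

Lemma mem_reflexive_closure S g :
  g \in reflexive_closure S <-> in_reflexive_closure S g.
Proof. exact: (svalP (cid (reflexive_closure_exists S))). Qed.

Lemma sub_reflexive_closure S : (S <= reflexive_closure S)%VS.
Proof.
by apply/subvP => s sS; apply/mem_reflexive_closure => x; exists s.
Qed.

Definition algebraically_reflexive S : Prop := reflexive_closure S = S.

(* The truncated subtraction is harmless by sub_reflexive_closure. *)
Definition reflexivity_defect S : nat :=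
  (\dim (reflexive_closure S) - \dim S)%N.

Definition rank1_in_line S : Prop :=
  exists D, [/\ (D <= S)%VS, \dim D = 1%N
    & forall s, s \in S -> \dim (limg s) = 1%N -> s \in D].

(* Column convention: column j holds the coordinates of s e_j in the basis f
   (the library's mxof acts on row vectors and is the transpose of this). *)
Definition op_matrix m n (e : n.-tuple U) (f : m.-tuple V) s : 'M[K]_(m, n) :=
  \matrix_(i, j) coord f i (s e`_j).

Definition represented_by m n S (E : 'M[K]_(m, n) -> Prop) : Prop :=
  exists (e : n.-tuple U) (f : m.-tuple V),
    [/\ basis_of fullv e, basis_of fullv f
      & forall s, s \in S <-> E (op_matrix e f s)].

End OperatorSpaces.

Section Exceptional.
Variable K : fieldType.

Definition mx_of_rows m n (rows : seq (seq K)) : 'M[K]_(m, n) :=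
  \matrix_(i, j) nth 0 (nth [::] rows i) j.

Definition E2 (M : 'M[K]_(2, 3)) : Prop :=
  exists a b : K,
    M = mx_of_rows _ _ [:: [:: a; b; 0];
                           [:: 0; a; b]].

Definition E3 (M : 'M[K]_(3, 3)) : Prop :=
  exists a b : K,
    M = mx_of_rows _ _ [:: [:: a; b; 0];
                           [:: 0; a; b];
                           [:: 0; 0; a]].

Definition E2T (M : 'M[K]_(3, 2)) : Prop := exists2 N, E2 N & M = N^T.

Definition has_two_elements : Prop := ([set: K] #= `I_2)%classic%card.

End Exceptional.

(* Main.v *)
Require Import Defs.
From HB Require Import structures.
From mathcomp Require Import all_boot all_order all_algebra all_field.
From mathcomp Require Import boolp classical_sets cardinality.
From mathcomp Require Import ring zify.

Set Implicit Arguments.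
Unset Strict Implicit.
Unset Printing Implicit Defensive.

Import GRing.Theory.

(** An operator g lies in the reflexive closure of S exactly when
    y (g x) = 0 for all vectors x and linear forms y such that y (s x) = 0 for
    all s in S.  Hence every form y satisfies y g = y r for some r in S
    ([closure_form]), and the problem is symmetric in U and V.  In particular S
    is reflexive when U or V has dimension at most 1.

    Let g be in the closure but not in S.  It may be changed by any element of
    S, and the heart of the matter is that some g - r has rank one.

    If the field has an element lam other than 0 and 1, take x killed by no
    nonzero operator of S, which exists by [pointwise_dependent] unless
    dim V <= 1, and choose r so that (g - r) x = 0.  Comparing g - r on u,
    x + u and x + lam u shows that its range lies in S x ([image_in_orbit]),
    and comparing the forms y (g - r) for y in a plane of forms excludes rank two
    ([closure_rank_le1]).  So let g be the operator u |-> phi(u) v, written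
    phi (x) v below.  At every u some nonzero operator of S then takes its
    value on the line of v; dependence modulo that line, and the dual argument
    on the kernel of phi, bound both dimensions by 2 ([small_dimensions]).

    If the field is F_2, then U is the union of the four kernels of the
    g - r with r in S, so one of them has codimension at most 1 by counting
    ([finite_field_cover]).  Writing g - r = phi (x) v, the affine hyperplane
    phi = 1 is covered by the three sets where s, t and s + t take the value v.
    Each of these sets has at most two points ([kernel_unique]), hence
    dim U <= 3, and the few possible coverings give bases that represent S by
    E2^T when dim U = 2 and dim V >= 3 ([represented_E2T]), and by E2 or E3 when
    dim U = 3 ([represented_E2_or_E3]).

    Finally, when dim U = 2, two independent rank-one operators of S have
    distinct kernel lines, and an element of the closure is determined on
    these two lines to be a combination of the two operators
    ([closure_rank1_in_line]); this leaves exception (i).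

    For the defects, evaluating an operator of the closure at the basis vectors
    and at one or two of their sums shows that the closure is S plus the line
    spanned by one explicit operator. *)

(** * Linear forms and two-dimensional spaces *)

Section LinearForms.
Local Open Scope ring_scope.
Variables (K : fieldType) (X : vectType K).
Implicit Types (x y : X) (W : {vspace X}) (f h : 'Hom(X, K^o)).

Lemma memv_addlineP W v x :
  reflect (exists c, x - c *: v \in W) (x \in (W + <[v]>)%VS).
Proof.
apply: (iffP idP) => [/memv_addP[w wW [_ /vlineP[c ->] ->]]|[c xW]].
  by exists c; rewrite addrK.
by rewrite -(subrK (c *: v) x) memv_add // memvZ // memv_line.
Qed.

Lemma mem_two_linesP s t x :
  reflect (exists a b, x = a *: s + b *: t) (x \in (<[s]> + <[t]>)%VS).
Proof.
apply: (iffP memv_addP) => [[_ /vlineP[a ->] [_ /vlineP[b ->] ->]]|[a [b ->]]].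
  by exists a, b.
by exists (a *: s); [|exists (b *: t)]; rewrite ?memvZ ?memv_line.
Qed.

Lemma lfun_factor (Y Z : vectType K) (f : 'Hom(X, Y)) (h : 'Hom(X, Z)) :
  (forall x, f x = 0 -> h x = 0) -> exists c : 'Hom(Y, Z), h = (c \o f)%VF.
Proof.
move=> ker_fh; exists (h \o f^-1)%VF; apply/lfunP => x; rewrite !comp_lfunE /=.
apply/eqP; rewrite -subr_eq0 -linearB; apply/eqP/ker_fh.
by rewrite linearB /= limg_lfunVK ?subrr // memv_img ?memvf.
Qed.

Lemma form_factor f h :
  (forall x, f x = 0 -> h x = 0) -> exists c : K, forall x, h x = c * f x.
Proof.
move=> /lfun_factor[c ->]; exists (c 1) => x; rewrite comp_lfunE.
by rewrite -{1}[f x]mulr1 -[_ * _]/(f x *: (1 : K^o)) linearZ /= mulrC.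
Qed.

(** A form vanishing on the common kernel of two forms lies in their span.  This
    is what turns a pointwise condition on operators into a relation between
    forms. *)
Lemma form_factor2 f1 f2 h :
  (forall x, f1 x = 0 -> f2 x = 0 -> h x = 0) ->
  exists a b : K, forall x, h x = a * f1 x + b * f2 x.
Proof.
move=> kerh; have [f1E|] := pselect (forall x, f1 x = 0 -> h x = 0).
  by have [c cE] := form_factor f1E; exists c, 0 => x; rewrite cE mul0r addr0.
move=> /existsNP[z /not_implyP[f1z /eqP hz]].
have f2z : f2 z != 0 by apply: contra_neq hz => /kerh->.
pose c := h z / f2 z.
have ker1 x : f1 x = 0 -> (h - c *: f2) x = 0.
  move=> f1x; have : h (x - (f2 x / f2 z) *: z) = 0.
    apply: kerh; rewrite linearB linearZ /= ?f1x ?f1z ?scaler0 ?subrr //.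
    by rewrite -[_ *: _]/(_ * _) divfK ?subrr.
  rewrite linearB linearZ /= => /subr0_eq hx.
  by rewrite add_lfunE opp_lfunE scale_lfunE hx /c -![_ *: _]/(_ * _); field.
have [a aE] := form_factor ker1; exists a, c => x.
by rewrite -aE add_lfunE opp_lfunE scale_lfunE subrK.
Qed.

Lemma dim_lker_form f : (\dim {:X} <= (\dim (lker f)).+1)%N.
Proof.
have := limg_ker_dim f fullv; rewrite capfv => <-.
rewrite -addn1 leq_add2l (leq_trans (dimvS (subvf _))) //.
by rewrite dimvf.
Qed.

Lemma dim_le2_forms f1 f2 :
  (forall x, f1 x = 0 -> f2 x = 0 -> x = 0) -> (\dim {:X} <= 2)%N.
Proof.
move=> ker0; have kerE : (lker f1 :&: lker f2 = 0)%VS.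
  apply/eqP; rewrite -subv0; apply/subvP => x; rewrite memv_cap !memv_ker memv0.
  by case/andP => /eqP f1x /eqP f2x; rewrite (ker0 x).
have := dimv_sum_cap (lker f1) (lker f2); rewrite kerE dimv0 addn0.
have := dimvS (subvf (lker f1 + lker f2)%VS); have := dim_lker_form f1;
  have := dim_lker_form f2; lia.
Qed.

Lemma dual_form x : x != 0 -> exists f, f x = 1.
Proof.
move=> x0; pose b := [tuple x];
  have freeb : free b by rewrite /free span_seq1 dim_vline x0.
exists (linfun (coord b 0 : X -> K^o)); rewrite lfunE /=.
by have := coord_free 0 0 freeb; rewrite /=.
Qed.

(** Coordinate forms on the plane of two independent vectors; they recover every
    vector only when that plane is the whole space. *)
Lemma dual_pair x y : x != 0 -> y \notin <[x]>%VS ->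
  exists f h, [/\ f x = 1, f y = 0, h x = 0, h y = 1
    & (\dim {:X} <= 2)%N -> forall z, z = f z *: x + h z *: y].
Proof.
move=> x0 yx; pose b := [tuple y; x].
have freeb : free b.
  by rewrite free_cons span_seq1 yx /= /free span_seq1 dim_vline x0.
pose crd i : 'Hom(X, K^o) := linfun (coord b i : X -> K^o).
have crdE i z : crd i z = coord b i z by exact: lfunE.
have E (i j : 'I_2) : crd j b`_i = (i == j)%:R by rewrite crdE coord_free.
exists (crd 1), (crd 0).
split; [exact: (E 1 1)|exact: (E 0 1)|exact: (E 1 0)|exact: (E 0 0)|].
move=> dimX z.
have zb : z \in <<b>>%VS.
  suff -> : <<b>>%VS = fullv by rewrite memvf.
  by apply/eqP; rewrite eqEdim subvf (eqP freeb).
rewrite !crdE [LHS](coord_span zb) !big_ord_recl big_ord0 addr0 addrC.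
by congr (coord b _ z *: _ + coord b _ z *: _); apply: val_inj.
Qed.

Lemma dim_two_lines x y : (\dim (<[x]> + <[y]>) <= 2)%N.
Proof. by have := dim_span [:: x; y]; rewrite !span_cons span_nil addv0. Qed.
End LinearForms.

(** * Reduced pencils and their reflexive closures *)

Section Pencils.
Local Open Scope ring_scope.
Variables (K : fieldType) (U V : vectType K).
Implicit Types (S : {vspace 'Hom(U, V)}) (r s t g : 'Hom(U, V)).

Lemma reduced_ker S x : reduced S -> (forall r, r \in S -> r x = 0) -> x = 0.
Proof.
by move=> [redS _] Sx0; apply/eqP; apply: contrapT => /negP/redS; apply.
Qed.

Lemma reduced_range S (Y : {vspace V}) :
  reduced S -> (forall r x, r \in S -> r x \in Y) -> Y = fullv.
Proof.
move=> [_ redS] SY; apply/eqP; rewrite eqEsubv subvf; apply/subvP => y _.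
have [rs /(_ _)rsS] := redS y.
suff : (\sum_(s <- rs) limg s <= Y)%VS by move=> /subvP; apply.
rewrite big_seq_cond; elim/big_rec: _ => [|r Z /andP[/rsS rS _] ZY];
  first exact: sub0v.
by rewrite subv_add ZY andbT; apply/subvP => _ /memv_imgP[x _ ->]; apply: SY.
Qed.

Lemma pencil_eq S r t : \dim S = 2%N -> r \in S -> t \in S -> r != 0 ->
  t \notin <[r]>%VS -> S = (<[r]> + <[t]>)%VS.
Proof.
move=> dimS rS tS r0 tr; apply/esym/eqP; rewrite eqEdim subv_add -!memvE rS tS /=.
have t0 : t != 0 by apply: contraNneq tr => ->; rewrite mem0v.
have := dimv_sum_cap <[r]> <[t]>.
suff -> : (<[r]> :&: <[t]> = 0)%VS.
  by rewrite dimv0 dimS !dim_vline r0 t0 addn0 => ->.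
apply/eqP; rewrite -subv0; apply/subvP => w; rewrite memv_cap memv0.
case/andP => wr /vlineP[c wE]; rewrite {}wE in wr *.
have [->|c0] := eqVneq c 0; first by rewrite scale0r.
by case/negP: tr; rewrite -[t](scalerK c0) memvZ.
Qed.

Lemma pencil_neq0 S : \dim S = 2%N -> exists2 s, s \in S & s != 0.
Proof.
move=> dimS; have : ~~ (S <= 0)%VS.
  by apply/negP => /dimvS; rewrite dimS dimv0.
by case/subvPn => s sS; rewrite memv0 => s0; exists s.
Qed.

Lemma pencil_complete S r : \dim S = 2%N -> r \in S -> r != 0 ->
  exists t, [/\ t \in S, t \notin <[r]>%VS & S = (<[r]> + <[t]>)%VS].
Proof.
move=> dimS rS r0.
have : ~~ (S <= <[r]>)%VS.
  by apply/negP => /dimvS; rewrite dimS dim_vline r0.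
by case/subvPn => t tS tr; exists t; split=> //; apply: pencil_eq.
Qed.

(** Choose s, x1, t and x2 with s x1 outside Y, t x1 in Y and t x2 outside Y.
    Dependence modulo Y at x2 and at x1 + x2 puts s x1 on the line of t x2, and
    exchanging the two lines puts all values on the line of s x1.  With Y = 0
    this provides separating vectors, and with Y a line it bounds dim V. *)
Lemma pointwise_dependent S (Y : {vspace V}) : \dim S = 2%N ->
  (forall x, exists r, [/\ r \in S, r != 0 & r x \in Y]) ->
  (forall r, r \in S -> (forall x, r x \in Y) -> r = 0) ->
  exists v, forall r x, r \in S -> r x \in (Y + <[v]>)%VS.
Proof.
move=> dimS dep noY.
have notin r : r \in S -> r != 0 -> exists x, r x \notin Y.
  move=> rS r0; apply: contrapT => /forallNP rY; case/eqP: r0; apply: noY => // x.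
  by apply: contrapT => /negP; apply: rY.
have [s sS s0] := pencil_neq0 dimS; have [x1 sx1] := notin _ sS s0.
have [t [tS t0 tx1]] := dep x1; have [x2 tx2] := notin _ tS t0.
have ts : t \notin <[s]>%VS.
  apply/negP => /vlineP[c tE]; move: t0 tx1;
    rewrite tE scaler_eq0 negb_or scale_lfunE.
  by case/andP => c0 _ sx1Y; case/negP: sx1; rewrite -[s x1](scalerK c0) memvZ.
have SE : S = (<[s]> + <[t]>)%VS by apply: pencil_eq.
have dep1 x : t x \notin Y -> s x \in (Y + <[t x]>)%VS.
  move=> txY; have [r [rS r0 rx]] := dep x; move: rS; rewrite SE.
  case/mem_two_linesP => a [b rE]; apply/memv_addlineP.
  have a0 : a != 0.
    apply: contraNneq txY => a0; move: rx r0;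
      rewrite rE a0 scale0r add0r scale_lfunE.
    rewrite scaler_eq0 negb_or => + /andP[b0 _].
    by move=> tY; rewrite -[t x](scalerK b0) memvZ.
  exists (- (b / a)); move: rx; rewrite rE add_lfunE !scale_lfunE => rx.
  rewrite scaleNr opprK -[X in X + _](scalerK a0) [b / a]mulrC -scalerA -scalerDr.
  by rewrite memvZ.
have dep2 x y : t x \in Y -> t y \notin Y -> s x \in (Y + <[t y]>)%VS.
  move=> txY tyY; have txy : t (x + y) \notin Y by rewrite linearD /= rpredDl.
  have subZ : (Y + <[t (x + y)%R]> <= Y + <[t y]>)%VS.
    rewrite subv_add addvSl -memvE linearD /= memvD //.
      exact: (subvP (addvSl _ _)).
    by rewrite (subvP (addvSr _ _)) ?memv_line.
  rewrite -(addrK (s y) (s x)) memvB ?dep1 // -[_ + _]linearD.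
  exact/(subvP subZ)/dep1.
have swap x y : s x \notin Y -> s x \in (Y + <[t y]>)%VS ->
  t y \in (Y + <[s x]>)%VS.
  move=> sxY /memv_addlineP[c sxy].
  have c0 : c != 0 by apply: contraNneq sxY => c0; move: sxy;
    rewrite c0 scale0r subr0.
  apply/memv_addlineP; exists c^-1.
  by rewrite -[t y](scalerK c0) -scalerBr memvZ // -opprB memvN.
have s1 x : t x \in (Y + <[s x1]>)%VS.
  have [txY|txY] := boolP (t x \in Y); first by rewrite (subvP (addvSl _ _)).
  by apply: swap => //; apply: dep2.
exists (s x1) => r x; rewrite SE => /mem_two_linesP[a [b ->]].
rewrite add_lfunE !scale_lfunE memvD // memvZ // ?s1 //.
have [sxY|sxY] := boolP (s x \in Y); first by rewrite (subvP (addvSl _ _)).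
have [txY|txY] := boolP (t x \in Y).
  apply: (subvP _ _ (dep2 _ _ txY tx2)); rewrite subv_add addvSl -memvE;
    exact: s1.
apply: (subvP _ _ (dep1 _ txY)); rewrite subv_add addvSl -memvE; exact: s1.
Qed.

Lemma closure_combination S s t h : S = (<[s]> + <[t]>)%VS ->
  in_reflexive_closure S h -> forall u, exists a b, h u = a *: s u + b *: t u.
Proof.
move=> SE hR u; have [r] := hR u; rewrite SE => /mem_two_linesP[a [b ->]] ->.
by exists a, b; rewrite add_lfunE !scale_lfunE.
Qed.

Lemma combination_closure S s t (h : 'Hom(U, V)) : S = (<[s]> + <[t]>)%VS ->
  (forall u, exists a b : K, h u = a *: s u + b *: t u) ->
    in_reflexive_closure S h.
Proof.
move=> SE hE u; have [a [b ->]] := hE u; exists (a *: s + b *: t).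
  by rewrite SE; apply/mem_two_linesP; exists a, b.
by rewrite add_lfunE !scale_lfunE.
Qed.

(** The closure passes to transposes: at each x the value y (g x) is a
    combination of y (s x) and y (t x), so the form y g vanishes where y s and
    y t do. *)
Lemma closure_form S g (y : 'Hom(V, K^o)) : \dim S = 2%N ->
  in_reflexive_closure S g -> exists2 r, r \in S & forall u, y (g u) = y (r u).
Proof.
move=> dimS gR.
have [s sS s0] := pencil_neq0 dimS.
have [t [tS _ SE]] := pencil_complete dimS sS s0.
have ker_g u : (y \o s)%VF u = 0 -> (y \o t)%VF u = 0 -> (y \o g)%VF u = 0.
  rewrite !comp_lfunE => ysu ytu; have [r rS ->] := gR u.
  move: rS; rewrite SE => /mem_two_linesP[a [b ->]].
  by rewrite add_lfunE !scale_lfunE linearD !linearZ /= ysu ytu !scaler0 addr0.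
have [a [b abE]] := form_factor2 ker_g; exists (a *: s + b *: t).
  by rewrite memvD ?memvZ.
move=> u; have := abE u; rewrite !comp_lfunE => ->.
by rewrite add_lfunE !scale_lfunE linearD !linearZ.
Qed.

(** On a line a single form is injective, so [closure_form] already gives the
    operator of S that equals g. *)
Lemma closure_codomain_le1 S g : \dim S = 2%N -> (\dim {:V} <= 1)%N ->
  in_reflexive_closure S g -> g \in S.
Proof.
move=> dimS dimV gR.
have [|/existsNP[v /eqP v0]] := pselect (forall v : V, v = 0).
  move=> V0; suff -> : g = 0 by rewrite mem0v.
  by apply/lfunP => u; rewrite [g u]V0 zero_lfunE.
have [y yv] := dual_form v0.
have VE : <[v]>%VS = fullv by apply/eqP; rewrite eqEdim subvf dim_vline v0.
have y_inj z : y z = 0 -> z = 0.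
  have : z \in <[v]>%VS by rewrite VE memvf.
  by case/vlineP => c ->; rewrite linearZ /= yv [_ *: _]mulr1 => ->;
    rewrite scale0r.
have [r rS yr] := closure_form y dimS gR.
suff -> : g = r by [].
by apply/lfunP => u; apply/subr0_eq/y_inj; rewrite linearB /= yr subrr.
Qed.

Lemma closure_domain_le1 S g : (\dim {:U} <= 1)%N ->
  in_reflexive_closure S g -> g \in S.
Proof.
move=> dimU gR.
have [u uE] : exists u : U, fullv = <[u]>%VS.
  have [U0|/existsNP[u /eqP u0]] := pselect (forall u : U, u = 0).
    by exists 0; apply/vspaceP => u; rewrite [u]U0 !mem0v.
  by exists u; apply/esym/eqP; rewrite eqEdim subvf dim_vline u0.
have [r rS gu] := gR u; suff -> : g = r by [].
apply/lfunP => w; have : w \in fullv by exact: memvf.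
by rewrite uE => /vlineP[c ->]; rewrite !linearZ /= gu.
Qed.

Lemma closure_sub S g r : r \in S -> in_reflexive_closure S g ->
  in_reflexive_closure S (g - r).
Proof.
move=> rS gR x; have [s sS gx] := gR x; exists (s - r); first by rewrite memvB.
by rewrite !add_lfunE gx.
Qed.

(** Two independent rank-one operators r and s of S have kernel lines spanned by
    some u and w, which are distinct because S is reduced.  At u only s
    survives and at w only r, so g u and g w prescribe g as a combination of
    r and s; this contradicts that g is not in S. *)
Lemma closure_rank1_in_line S g : \dim S = 2%N -> reduced S -> \dim {:U} = 2%N ->
  in_reflexive_closure S g -> g \notin S -> rank1_in_line S.
Proof.
move=> dimS redS dimU gR gS.
have ker1 r : \dim (limg r) = 1%N -> exists2 u, u != 0 & r u = 0.
  move=> dimr; have := limg_ker_dim r fullv;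
    rewrite capfv dimr dimU addn1 => -[dimk].
  have : ~~ (lker r <= 0)%VS by apply/negP => /dimvS; rewrite dimk dimv0.
  by case/subvPn => u; rewrite memv_ker memv0 => /eqP ru u0; exists u.
have [[r [rS r1]]|/forallNP nor1] := pselect (exists r, r \in S /\ \dim (limg
  r) = 1%N); last first.
  have [s sS s0] := pencil_neq0 dimS; exists <[s]>%VS.
  split; [by rewrite -memvE|by rewrite dim_vline s0|].
  by move=> r rS r1; case: (nor1 r).
have r0 : r != 0 by apply: contra_eq_neq r1 => ->; rewrite lim0g dimv0.
exists <[r]>%VS; split; [by rewrite -memvE|by rewrite dim_vline r0|].
move=> s sS s1; apply/negPn/negP => sr; case/negP: gS.
have SE := pencil_eq dimS rS sS r0 sr.
have [u u0 ru] := ker1 _ r1; have [w w0 sw] := ker1 _ s1.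
have wu : w \notin <[u]>%VS.
  apply/negP => /vlineP[c wE]; case/eqP: w0; apply: (reduced_ker redS) => q.
  rewrite SE => /mem_two_linesP[a [b ->]]; rewrite add_lfunE !scale_lfunE sw.
  by rewrite wE linearZ /= ru !scaler0 addr0.
have [q1 q1S gu] := gR u; have [q2 q2S gw] := gR w.
move: q1S q2S gu gw; rewrite SE => /mem_two_linesP[a1 [b1 ->]]
  /mem_two_linesP[a2 [b2 ->]].
rewrite !add_lfunE !scale_lfunE ru sw !scaler0 add0r addr0 => gu gw.
apply/mem_two_linesP; exists a2, b1; apply/lfunP => z.
have [f [h [_ _ _ _ fhE]]] := dual_pair u0 wu.
rewrite (fhE _ z) ?dimU // !linearD !linearZ /= gu gw.
by rewrite !add_lfunE !scale_lfunE ru sw !scaler0 add0r addr0.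
Qed.
End Pencils.

(** * Fields with at least three elements *)

Section LargeFields.
Local Open Scope ring_scope.
Variables (K : fieldType) (U V : vectType K).
Implicit Types (S : {vspace 'Hom(U, V)}) (r s t g : 'Hom(U, V)).

Definition separating S (x : U) := forall r, r \in S -> r x = 0 -> r = 0.

(** Suppose that g u is not in S x, and let s u = g u and S = <s, t>.  For mu
    nonzero, g (x + mu u) = mu g u lies in S (x + mu u), which forces
    t x + mu t u into the span of g u and s x.  Eliminating t u between mu = 1
    and mu = lam puts t x in that span: this contradicts either that x is
    separating or that g u is not in S x. *)
Lemma image_in_orbit S g x (lam : K) : \dim S = 2%N -> lam != 0 -> lam != 1 ->
  in_reflexive_closure S g -> separating S x -> g x = 0 ->
  forall u, exists2 r, r \in S & g u = r x.
Proof.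
move=> dimS lam0 lam1 gR sepx gx u; apply: contrapT => /forall2NP noS.
have {}noS r : r \in S -> g u != r x.
  by move=> rS; apply/eqP => E; case: (noS r).
have gu0 : g u != 0 by have := noS 0 (mem0v _); rewrite zero_lfunE.
have [s sS gsu] := gR u.
have s0 : s != 0 by apply: contraNneq gu0 => s0; rewrite gsu s0 zero_lfunE.
have [t [tS ts SE]] := pencil_complete dimS sS s0.
have tx mu : mu != 0 -> exists c d, t x + mu *: t u = c *: g u + d *: s x.
  move=> mu0; have [r rS] := gR (x + mu *: u).
  move: rS; rewrite SE => /mem_two_linesP[a [b ->]].
  rewrite add_lfunE !scale_lfunE !linearD !linearZ /= gx add0r -gsu => E.
  have bE : b *: (t x + mu *: t u) = (mu * (1 - a)) *: g u - a *: s x.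
    rewrite mulrBr mulr1 scalerBl E !scalerDr !scalerA [mu * a]mulrC [mu *
      b]mulrC.
    by rewrite -[RHS]addrA -opprD [X in _ - X]addrC addrAC subrr add0r.
  (* if b = 0 then mu (1 - a) g u = a s x, so g u would be in S x or s x = 0 *)
  have b0 : b != 0.
    apply/eqP => b0; move: bE; rewrite b0 scale0r => /esym/eqP.
    rewrite subr_eq0 => /eqP gE.
    have [a1|a1] := eqVneq (1 - a) 0.
      move: gE; rewrite a1 mulr0 scale0r; have <- := subr0_eq a1; rewrite scale1r.
      by move=> /esym /sepx s0'; rewrite s0' ?eqxx in s0.
    have := noS ((mu * (1 - a))^-1 *: (a *: s));
      rewrite !memvZ // !scale_lfunE -gE.
    by rewrite scalerK ?mulf_neq0 // eqxx => /(_ isT).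
  exists (b^-1 * (mu * (1 - a))), (- (b^-1 * a)).
  by rewrite -[LHS](scalerK b0) bE scalerBr !scalerA scaleNr.
have [c1 [d1 E1]] := tx 1 (oner_neq0 _); have [c2 [d2 E2]] := tx lam lam0.
rewrite scale1r in E1.
have E : (lam - 1) *: t x = (lam * c1 - c2) *: g u + (lam * d1 - d2) *: s x.
  have -> : (lam - 1) *: t x = lam *: (t x + t u) - (t x + lam *: t u).
    by rewrite scalerBl scale1r scalerDr opprD addrACA subrr addr0.
  by rewrite E1 E2 scalerDr !scalerA !scalerBl opprD addrACA.
have l1 : lam - 1 != 0 by rewrite subr_eq0.
have [C0|C0] := eqVneq (lam * c1 - c2) 0.
  move: E; rewrite C0 scale0r add0r => /eqP;
    rewrite -subr_eq0 -!scale_lfunE -opp_lfunE -add_lfunE.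
  move=> /eqP /sepx E; have {}E : (lam - 1) *: t = (lam * d1 - d2) *: s.
    by apply/subr0_eq/E; rewrite memvB ?memvZ.
  by case/negP: ts; rewrite -[t](scalerK l1) E !memvZ ?memv_line.
have := noS ((lam * c1 - c2)^-1 *: ((lam - 1) *: t - (lam * d1 - d2) *: s)).
rewrite memvZ ?memvB ?memvZ // => /(_ isT).
by rewrite !scale_lfunE add_lfunE opp_lfunE !scale_lfunE E addrK scalerK // eqxx.
Qed.

(** The scalar contradiction behind [closure_rank_le1]: both equations compute
    1 / k, so mu (d + b) = e - c for two values of mu, hence d = - b and e = c,
    and then c + mu d vanishes at mu = c / b. *)
Lemma no_rank2_values (lam c b d e : K) : lam != 0 -> lam != 1 -> c != 0 ->
  b != 0 ->
  (forall mu, exists k, k * (c + mu * d) = 1 /\ k * (mu * e - mu ^+ 2 * b) =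
    mu) -> False.
Proof.
move=> lam0 lam1 c0 b0 H.
have lin mu : mu != 0 -> c + mu * d != 0 /\ mu * (d + b) = e - c.
  move=> mu0; have [k [k1 kmu]] := H mu.
  have k0 : k != 0 by apply: contra_eq_neq k1 => ->;
    rewrite mul0r eq_sym oner_neq0.
  split; first by apply: contra_eq_neq k1 => ->; rewrite mulr0 eq_sym oner_neq0.
  have : k * mu * (mu * (d + b)) = k * mu * (e - c).
    have -> : k * mu * (mu * (d + b)) =
      mu * (k * (c + mu * d)) - k * (mu * e - mu ^+ 2 * b) + k * mu * (e - c)
        by ring.
    by rewrite k1 kmu mulr1 subrr add0r.
  by move/mulfI; apply; rewrite mulf_neq0.
have [_ E1] := lin 1 (oner_neq0 _); have [_ E2] := lin lam lam0.
have db : d + b = 0.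
  apply/eqP; have : (lam - 1) * (d + b) == 0.
    by rewrite mulrBl E2 mul1r -[d + b]mul1r E1 subrr.
  by rewrite mulf_eq0 subr_eq0 (negbTE lam1).
have mu0 : c / b != 0 by rewrite mulf_neq0 ?invr_neq0.
have dE : d = - b by rewrite -(addr0_eq db) opprK.
by have [] := lin _ mu0; rewrite dE mulrN divfK // subrr eqxx.
Qed.

(** If g had rank two, its range would be the plane S x, with basis
    g u1 = r1 x and g u2 = r2 x and coordinate forms f1, f2.  For
    y = f1 + mu f2, the operator r in S with y g = y r satisfies y (r x) = 0,
    so it is a multiple k of r2 - mu r1.  Evaluating at u1 and u2 gives a
    family of scalar equations in mu with no solution. *)
Lemma closure_rank_le1 S g x (lam : K) : \dim S = 2%N -> lam != 0 -> lam != 1 ->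
  in_reflexive_closure S g -> separating S x -> g x = 0 ->
  exists v, forall u, g u \in <[v]>%VS.
Proof.
move=> dimS lam0 lam1 gR sepx gx.
have gS := image_in_orbit dimS lam0 lam1 gR sepx gx.
have [g0|/existsNP[u1 /eqP gu1]] := pselect (forall u, g u = 0).
  by exists 0 => u; rewrite g0 mem0v.
apply: contrapT => /forallNP/(_ (g u1))/existsNP[u2 /negP gu2].
have [r1 r1S r1x] := gS u1; have [r2 r2S r2x] := gS u2.
have r10 : r1 != 0 by apply: contraNneq gu1 => r10; rewrite r1x r10 zero_lfunE.
have r12 : r2 \notin <[r1]>%VS.
  apply: contraNN gu2 => /vlineP[c r2E].
  by rewrite r2x r2E scale_lfunE -r1x memvZ ?memv_line.
have SE := pencil_eq dimS r1S r2S r10 r12.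
have [f1 [f2 [f11 f12 f21 f22 _]]] := dual_pair gu1 gu2.
have form mu : exists k : K, forall u,
    f1 (g u) + mu * f2 (g u) =
    k * (f1 (r2 u) + mu * f2 (r2 u) - mu * (f1 (r1 u) + mu * f2 (r1 u))).
  have [r] := closure_form (f1 + mu *: f2) dimS gR.
  rewrite SE => /mem_two_linesP[a [b ->]] rE; exists b => u; move: (rE x) (rE u).
  rewrite !(add_lfunE, scale_lfunE) !linearD !linearZ /= gx -r1x -r2x.
  rewrite !linear0 f11 f12 f21 f22 -![_ *: _]/(_ * _) => E0 E1.
  have aE : a = - (mu * b).
    by apply/eqP; rewrite -addr_eq0 mulrC; move: E0;
      rewrite !(mulr0, mulr1, add0r, addr0) => <-.
  by rewrite E1 aE; ring.
(* the form f2 plays the role of mu at infinity *)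
have [k2 form2] : exists k : K, forall u, f2 (g u) = k * f2 (r1 u).
  have [r] := closure_form f2 dimS gR.
  rewrite SE => /mem_two_linesP[a [b ->]] rE; exists a => u; move: (rE x) (rE u).
  rewrite !(add_lfunE, scale_lfunE) !linearD !linearZ /= gx -r1x -r2x.
  rewrite !linear0 f21 f22 -![_ *: _]/(_ * _) mulr0 mulr1 add0r => <-.
  by rewrite mul0r addr0.
have [k0 form0] := form 0.
have := form2 u1; have := form2 u2; have := form0 u1; have := form0 u2.
rewrite f11 f12 f21 f22 !mul0r !addr0 !subr0 => C2 C1 B2 B1.
have k20 : k2 != 0 by apply: contra_eq_neq B2 => ->; rewrite mul0r oner_neq0.
have k00 : k0 != 0 by apply: contra_eq_neq C1 => ->; rewrite mul0r oner_neq0.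
have b0 : f2 (r1 u2) != 0 by apply: contra_eq_neq B2 => ->;
  rewrite mulr0 oner_neq0.
have c0 : f1 (r2 u1) != 0 by apply: contra_eq_neq C1 => ->;
  rewrite mulr0 oner_neq0.
have {}B1 : f2 (r1 u1) = 0.
  by move/esym/eqP: B1; rewrite mulf_eq0 (negbTE k20) => /eqP.
have {}C2 : f1 (r2 u2) = 0.
  by move/esym/eqP: C2; rewrite mulf_eq0 (negbTE k00) => /eqP.
apply: (@no_rank2_values lam _ _ (f2 (r2 u1) - f1 (r1 u1)) (f2 (r2 u2) - f1 (r1
  u2)) lam0 lam1 c0 b0).
move=> mu; have [k kE] := form mu; exists k; move: (kE u1) (kE u2).
rewrite f11 f12 f21 f22 B1 C2 !mulr0 !addr0 !add0r mulr1 => E1 E2; split.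
  by rewrite E1 mulrBr addrA.
rewrite [RHS]E2; congr (k * _).
by rewrite mulrBr mulrDr opprD addrA expr2 mulrA.
Qed.

Lemma line_valued g v : (forall u, g u \in <[v]>%VS) ->
  exists phi : 'Hom(U, K^o), forall u, g u = (phi u : K) *: v.
Proof.
move=> gv; have [v0|v0] := eqVneq v 0.
  exists 0 => u; have := gv u.
  by rewrite v0 => /vlineP[c ->]; rewrite !scaler0.
have [y yv] := dual_form v0; exists (y \o g)%VF => u.
rewrite comp_lfunE; have /vlineP[c ->] := gv u.
by rewrite linearZ /= yv [_ *: 1]mulr1.
Qed.

Section RankOne.
Variables (S : {vspace 'Hom(U, V)}) (g : 'Hom(U, V)) (v : V) (phi : 'Hom(U, K^o)).
Hypotheses (dimS : \dim S = 2%N) (redS : reduced S).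
Hypotheses (gR : in_reflexive_closure S g) (gS : g \notin S).
Hypothesis gE : forall u, g u = (phi u : K) *: v.

Lemma rank1_vector_neq0 : v != 0.
Proof.
apply: contraNneq gS => v0; suff -> : g = 0 by rewrite mem0v.
by apply/lfunP => u; rewrite gE v0 scaler0 zero_lfunE.
Qed.

Lemma rank1_form_eq1 : exists e, phi e = 1.
Proof.
have [phi0|/existsNP[u /eqP pu]] := pselect (forall u, phi u = 0).
  case/negP: gS; suff -> : g = 0 by rewrite mem0v.
  by apply/lfunP => u; rewrite gE phi0 scale0r zero_lfunE.
by exists ((phi u)^-1 *: u); rewrite linearZ /= [_ *: _]mulVf.
Qed.

Lemma orbit_through_v r t : S = (<[r]> + <[t]>)%VS ->
  forall u, exists a b, phi u *: v = a *: r u + b *: t u.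
Proof.
move=> SE u; have [a [b guE]] := closure_combination SE gR u.
by exists a, b; rewrite -gE.
Qed.

(** Let r = psi (x) v and S = <r, t>.  Where psi u = 0 and phi u != 0, only t can
    contribute v to S u, so t u is on the line of v; such vectors span the
    kernel of psi.  Hence t maps that kernel injectively into the line of v, and
    the ranges of S lie in the span of v and one value of t. *)
Lemma small_of_image_line r : r \in S -> r != 0 -> (forall u, r u \in <[v]>%VS) ->
  (\dim {:U} <= 2)%N /\ (\dim {:V} <= 2)%N.
Proof.
move=> rS r0 rv; have [psi rE] := line_valued rv.
have [u0 pu0 fu0] : exists2 u, psi u = 0 & phi u != 0.
  apply: contrapT => /forall2NP H.
  have kerE u : psi u = 0 -> phi u = 0.
    by move=> pu; case: (H u) => // /negP; rewrite negbK => /eqP.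
  have [c cE] := form_factor kerE; case/negP: gS.
  suff -> : g = c *: r by rewrite memvZ.
  by apply/lfunP => u; rewrite gE cE scale_lfunE rE scalerA.
have [t [tS _ SE]] := pencil_complete dimS rS r0.
have tv' u : psi u = 0 -> phi u != 0 -> t u \in <[v]>%VS.
  move=> pu fu; have [a [b]] := orbit_through_v SE u.
  rewrite rE pu scale0r scaler0 add0r => E.
  have b0 : b != 0.
    apply/eqP => b0; move/eqP: E; rewrite b0 scale0r scaler_eq0 (negbTE fu) /=.
    exact/negP/rank1_vector_neq0.
  by rewrite -[t u](scalerK b0) -E !memvZ ?memv_line.
have tv u : psi u = 0 -> t u \in <[v]>%VS.
  move=> pu; have [fu|fu] := eqVneq (phi u) 0; last exact: tv'.
  rewrite -(addrK (t u0) (t u)) memvB ?tv' // -[_ + _]linearD tv' //.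
    by rewrite linearD /= pu pu0 addr0.
  by rewrite linearD /= fu add0r.
have [y yv] := dual_form rank1_vector_neq0.
split.
  apply: (@dim_le2_forms _ _ psi (y \o t)%VF) => u pu; rewrite comp_lfunE => ytu.
  apply: (reduced_ker redS) => s; rewrite SE => /mem_two_linesP[a [b ->]].
  rewrite add_lfunE !scale_lfunE rE pu scale0r scaler0 add0r.
  have /vlineP[c tE] := tv u pu; move: ytu;
    rewrite tE linearZ /= yv [_ *: 1]mulr1 => ->.
  by rewrite scale0r scaler0.
have [u1 pu1] : exists u1, psi u1 = 1.
  have [psi0|/existsNP[u /eqP pu]] := pselect (forall u, psi u = 0).
    case/eqP: r0; apply/lfunP => u; by rewrite rE psi0 scale0r zero_lfunE.
  by exists ((psi u)^-1 *: u); rewrite linearZ /= [_ *: _]mulVf.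
have <- : (<[v]> + <[t u1]>)%VS = fullv.
  apply: (reduced_range redS) => s u; rewrite SE => /mem_two_linesP[a [b ->]].
  rewrite add_lfunE !scale_lfunE memvD // memvZ //.
    exact: (subvP (addvSl _ _)).
  have -> : t u = t (u - psi u *: u1) + psi u *: t u1.
    by rewrite linearB linearZ subrK.
  rewrite memv_add ?memvZ ?memv_line // tv //.
  by rewrite linearB linearZ /= pu1 [_ *: 1]mulr1 subrr.
exact: dim_two_lines.
Qed.

(** Here r = phi (x) w with v, w a basis of V.  Where phi u != 0, the vector v is
    in S u = <w, t u>, so the v-coordinate of t u is nonzero.  That coordinate
    is therefore proportional to phi, and t maps the kernel of phi injectively to
    the line of w. *)
Lemma small_of_kernel_hyperplane r : (\dim {:V} <= 2)%N -> r \in S -> r != 0 ->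
  (forall u, phi u = 0 -> r u = 0) -> (\dim {:U} <= 2)%N.
Proof.
move=> dimV rS r0 rphi; have [e phie] := rank1_form_eq1.
pose w := r e.
have rE u : r u = phi u *: w.
  apply/eqP; rewrite -subr_eq0 /w -linearZ -linearB /= rphi //.
  by rewrite linearB linearZ /= phie [_ *: 1]mulr1 subrr.
have v0 := rank1_vector_neq0.
have wv : w \notin <[v]>%VS.
  apply: contraNN gS => /vlineP[c wE].
  have c0 : c != 0.
    apply: contraNneq r0 => c0; apply/eqP/lfunP => u.
    by rewrite rE wE c0 scale0r scaler0 zero_lfunE.
  suff -> : g = c^-1 *: r by rewrite memvZ.
  apply/lfunP => u; rewrite gE scale_lfunE rE wE !scalerA; congr (_ *: _).
  by rewrite mulrAC mulVf ?mul1r.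
have [z [o [zv zw ov ow /(_ dimV) zoE]]] := dual_pair v0 wv.
have [t [tS _ SE]] := pencil_complete dimS rS r0.
have zt u : (z \o t)%VF u = 0 -> phi u = 0.
  rewrite comp_lfunE => ztu; have [a [b]] := orbit_through_v SE u.
  move/(congr1 z); rewrite linearD !linearZ /= rE linearZ /= zw ztu zv.
  by rewrite !scaler0 addr0 [_ *: 1]mulr1.
have [c cE] := form_factor zt.
apply: (@dim_le2_forms _ _ phi (o \o t)%VF) => u pu; rewrite comp_lfunE => otu.
have c0 : c != 0.
  apply/eqP => c0; move/eqP: phie; rewrite cE c0 mul0r eq_sym;
    exact/negP/oner_neq0.
have ztu : z (t u) = 0.
  by move: pu; rewrite cE comp_lfunE => /eqP;
    rewrite mulf_eq0 (negbTE c0) => /eqP.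
apply: (reduced_ker redS) => s; rewrite SE => /mem_two_linesP[a [b ->]].
rewrite add_lfunE !scale_lfunE rphi // scaler0 add0r (zoE (t u)) ztu otu.
by rewrite !scale0r addr0 scaler0.
Qed.

(** Let y, h be the coordinates of V on v and a complement.  By [closure_form],
    phi = (y + mu h) r_mu for some r_mu in S, for mu = 0, 1 and lam.  Unless an
    operator of S vanishes on the kernel of phi, r_0 and r_1 are independent,
    and writing r_lam in terms of them shows that on the kernel of phi the
    single form h r_1 controls both r_0 and r_1. *)
Lemma small_domain (lam : K) : lam != 0 -> lam != 1 -> (\dim {:V} <= 2)%N ->
  (\dim {:U} <= 2)%N.
Proof.
move=> lam0 lam1 dimV; have v0 := rank1_vector_neq0;
  have [e phie] := rank1_form_eq1.
have [[r [rS r0 rphi]]|/forallNP noker] :=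
    pselect (exists r, [/\ r \in S, r != 0 & forall u, phi u = 0 -> r u = 0]).
  exact: small_of_kernel_hyperplane rphi.
have {}noker r : r \in S -> (forall u, phi u = 0 -> r u = 0) -> r = 0.
  by move=> rS rphi; apply/eqP; apply: contrapT => /negP r0; apply: (noker r).
have [w wv] : exists w, w \notin <[v]>%VS.
  have : ~~ (fullv <= <[v]>)%VS.
    apply: contraNN gS => /dimvS; rewrite dim_vline v0 => dimV1.
    exact: closure_codomain_le1.
  by case/subvPn => w _ wv; exists w.
have [y [h [yv yw hv hw /(_ dimV) yhE]]] := dual_pair v0 wv.
have form mu : exists2 r, r \in S & forall u, phi u = y (r u) + mu * h (r u).
  have [r rS rE] := closure_form (y + mu *: h) dimS gR; exists r => // u.
  move: (rE u); rewrite !(add_lfunE, scale_lfunE) gE !linearZ /= yv hv.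
  by rewrite [_ *: 1]mulr1 !scaler0 addr0.
have yh0 z : y z = 0 -> h z = 0 -> z = 0.
  by move=> yz hz; rewrite (yhE z) yz hz !scale0r addr0.
have [r0 r0S r0E] := form 0; have [r1 r1S r1E] := form 1.
have [r2 r2S r2E] := form lam.
have nz r mu : (forall u, phi u = y (r u) + mu * h (r u)) -> r != 0.
  move=> rE; apply/eqP => r0'; move/eqP: (rE e).
  by rewrite r0' zero_lfunE !linear0 mulr0 addr0 phie oner_eq0.
have yr0 u : phi u = 0 -> y (r0 u) = 0 by rewrite r0E mul0r addr0.
have yr1 u : phi u = 0 -> y (r1 u) = - h (r1 u).
  by rewrite r1E mul1r => /eqP; rewrite addr_eq0 => /eqP.
have r10 : r1 \notin <[r0]>%VS.
  apply/negP => /vlineP[c r1c]; case/eqP: (nz _ _ r0E); apply: noker => // u pu.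
  apply: yh0 (yr0 _ pu) _; move: (yr1 _ pu); rewrite r1c scale_lfunE !linearZ /=.
  rewrite yr0 // scaler0 => /esym/eqP; rewrite [_ == _]mulf_eq0 oppr_eq0.
  case/orP => /eqP // c0; by move: (nz _ _ r1E); rewrite r1c c0 scale0r eqxx.
have SE := pencil_eq dimS r0S r1S (nz _ _ r0E) r10.
move: (r2S); rewrite SE => /mem_two_linesP[a [b r2ab]].
have a0 : a != 0.
  apply/eqP => a0; case/eqP: (nz _ _ r1E); apply: noker => // u pu.
  have hr1 : h (r1 u) = 0.
    have := r2E u; rewrite pu r2ab a0 scale0r add0r scale_lfunE !linearZ /= yr1
      //.
    rewrite -![_ *: _]/(_ * _) => E.
    have : b * (lam - 1) * h (r1 u) = 0 by rewrite [RHS]E; ring.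
    move/eqP; rewrite !mulf_eq0 subr_eq0 (negbTE lam1) orbF.
    case/orP => /eqP // b0; by move: (nz _ _ r2E);
      rewrite r2ab a0 b0 !scale0r addr0 eqxx.
  by apply: yh0 => //; rewrite yr1 // hr1 oppr0.
apply: (@dim_le2_forms _ _ phi (h \o r1)%VF) => u pu; rewrite comp_lfunE => hr1.
have r1u : r1 u = 0 by apply: yh0 => //; rewrite yr1 // hr1 oppr0.
have r0u : r0 u = 0.
  apply: yh0; first exact: yr0.
  have := r2E u; rewrite pu r2ab add_lfunE !scale_lfunE r1u scaler0 addr0
    !linearZ /=.
  rewrite yr0 // scaler0 add0r => /esym/eqP;
    rewrite !mulf_eq0 (negbTE lam0) (negbTE a0) /=.
  by move=> /eqP.
apply: (reduced_ker redS) => s; rewrite SE => /mem_two_linesP[c [d ->]].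
by rewrite add_lfunE !scale_lfunE r0u r1u !scaler0 addr0.
Qed.

(** At each u some nonzero operator of S takes its value on the line of v: if
    phi u != 0 because g u is a nonzero multiple of v, and if phi u = 0 and u is
    separating because v is in S u by [image_in_orbit]. *)
Lemma small_dimensions (lam : K) : lam != 0 -> lam != 1 ->
  (\dim {:U} <= 2)%N /\ (\dim {:V} <= 2)%N.
Proof.
move=> lam0 lam1.
have [[r [rS r0 rv]]|/forallNP noline] :=
    pselect (exists r, [/\ r \in S, r != 0 & forall u, r u \in <[v]>%VS]).
  exact: small_of_image_line rv.
have [w vwE] : exists w, forall r u, r \in S -> r u \in (<[v]> + <[w]>)%VS.
  apply: pointwise_dependent => // [u|r rS rv]; last first.
    by apply/eqP; apply: contrapT => /negP r0; apply: (noline r).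
  apply: contrapT => /forallNP nor.
  have sepu : separating S u.
    move=> r rS ru; apply/eqP; apply: contrapT => /negP r0; apply: (nor r).
    by rewrite ru mem0v.
  have [pu|pu] := eqVneq (phi u) 0.
    have gu : g u = 0 by rewrite gE pu scale0r.
    have [e phie] := rank1_form_eq1.
    have [r rS rv] := image_in_orbit dimS lam0 lam1 gR sepu gu e.
    apply: (nor r); split=> //; last by rewrite -rv gE memvZ ?memv_line.
    by apply: contraTneq rank1_vector_neq0 => r0;
      rewrite -(scale1r v) -phie -gE rv r0 zero_lfunE eqxx.
  have [r rS gu] := gR u; apply: (nor r); split=> //;
    last by rewrite -gu gE memvZ ?memv_line.
  apply: contraTneq rank1_vector_neq0 => r0; have /eqP := gu.
  by rewrite gE r0 zero_lfunE scaler_eq0 (negbTE pu) /= => ->.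
have VE := reduced_range redS (fun r u rS => vwE r u rS).
have dimV : (\dim {:V} <= 2)%N.
  by rewrite -VE dim_two_lines.
by split=> //; exact: (small_domain lam0 lam1 dimV).
Qed.
End RankOne.

Lemma separating_exists S g : \dim S = 2%N -> reduced S -> 
  in_reflexive_closure S g -> g \notin S -> exists x, separating S x.
Proof.
move=> dimS redS gR gS; apply: contrapT => /forallNP nosep; case/negP: gS.
have [v vE] : exists v, forall r u, r \in S -> r u \in (0 + <[v]>)%VS.
  apply: pointwise_dependent => // [u|r rS r0]; last first.
    by apply/lfunP => u; rewrite zero_lfunE; apply/eqP; rewrite -memv0.
  apply: contrapT => /forallNP nor; apply: (nosep u) => r rS ru.
  apply/eqP; apply: contrapT => /negP r0; apply: (nor r).
  by rewrite ru mem0v.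
apply: (closure_codomain_le1 dimS) gR;
  rewrite -(reduced_range redS (fun r u rS => vE r u rS)).
by rewrite add0v dim_vline; case: (_ != 0).
Qed.

Lemma large_field_exception S g (lam : K) : lam != 0 -> lam != 1 ->
  \dim S = 2%N -> reduced S -> in_reflexive_closure S g -> g \notin S ->
  [/\ \dim {:U} = 2%N, \dim {:V} = 2%N & rank1_in_line S].
Proof.
move=> lam0 lam1 dimS redS gR gS.
have [x sepx] := separating_exists dimS redS gR gS.
have [r rS gx] := gR x; have gR' := closure_sub rS gR.
have gS' : g - r \notin S by apply: contraNN gS => gr; rewrite -(subrK r g) memvD.
have gx' : (g - r) x = 0 by rewrite add_lfunE opp_lfunE gx subrr.
have [v gv] := closure_rank_le1 dimS lam0 lam1 gR' sepx gx'.
have [phi phiE] := line_valued gv.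
have [dimU dimV] := small_dimensions dimS redS gR' gS' phiE lam0 lam1.
have dimU2 : \dim {:U} = 2%N.
  by apply/eqP; rewrite eqn_leq dimU ltnNge;
    apply: contraNN gS => /closure_domain_le1; apply.
have dimV2 : \dim {:V} = 2%N.
  by apply/eqP; rewrite eqn_leq dimV ltnNge;
    apply: contraNN gS => /(closure_codomain_le1 dimS); apply.
by split=> //; apply: closure_rank1_in_line gR gS.
Qed.
End LargeFields.

(** * Matrix representations of a pencil *)

Section Representations.
Local Open Scope ring_scope.
Variables (K : fieldType) (U V : vectType K).
Implicit Types (S : {vspace 'Hom(U, V)}) (r s t g : 'Hom(U, V)).

Lemma lfun_on_basis n (e : n.-tuple U) (w : n.-tuple V) : basis_of fullv e ->
  exists g : 'Hom(U, V), forall j : 'I_n, g e`_j = w`_j.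
Proof.
move=> be; have [h hE] := linear_of_free e w.
exists (linfun h) => j; rewrite lfunE /= -(hE (basis_free be)) ?size_tuple //.
by rewrite (nth_map 0) ?size_tuple.
Qed.

Section Bases.
Variables (m n : nat) (e : n.-tuple U) (f : m.-tuple V).
Hypotheses (basis_e : basis_of fullv e) (basis_f : basis_of fullv f).

Lemma op_matrixP r (M : 'M[K]_(m, n)) :
  op_matrix e f r = M <-> forall j : 'I_n, r e`_j = \sum_i M i j *: f`_i.
Proof.
have [free_f span_f] := (basis_free basis_f, span_basis basis_f).
split=> [<- j|rE]; last first.
  by apply/matrixP => i j; rewrite mxE rE coord_sum_free.
rewrite {1}(@coord_span _ _ _ f (r e`_j)) ?span_f ?memvf //.
by apply: eq_bigr => i _; rewrite mxE.
Qed.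

Lemma op_matrix_pencil s t a b : op_matrix e f (a *: s + b *: t) =
  a *: op_matrix e f s + b *: op_matrix e f t.
Proof.
by apply/matrixP => i j; rewrite !mxE add_lfunE !scale_lfunE linearD !linearZ.
Qed.

Lemma lfun_eq_basis r r' : (forall j : 'I_n, r e`_j = r' e`_j) -> r = r'.
Proof.
move=> rr'; apply/lfunP => u.
rewrite (@coord_span _ _ _ e u) ?(span_basis basis_e) ?memvf // !linear_sum /=.
by apply: eq_bigr => j _; rewrite !linearZ /= rr'.
Qed.

Lemma op_matrix_inj : injective (op_matrix e f).
Proof.
move=> r r' rr'; apply: lfun_eq_basis => j.
have /op_matrixP rE := rr'; have /op_matrixP r'E := erefl (op_matrix e f r').
by rewrite rE r'E.
Qed.

Lemma op_matrix_surj M : exists r, op_matrix e f r = M.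
Proof.
have [r rE] := lfun_on_basis [tuple \sum_i M i j *: f`_i | j < n] basis_e.
by exists r; apply/op_matrixP => j; rewrite rE nth_mktuple.
Qed.

(** For the matrix pencil E spanned by M1 and M2, only the matrices of two
    generators of S have to be computed. *)
Lemma represented_by_pencil s t S (E : 'M[K]_(m, n) -> Prop) M1 M2 :
  (forall M, E M <-> exists a b, M = a *: M1 + b *: M2) ->
  S = (<[s]> + <[t]>)%VS -> op_matrix e f s = M1 -> op_matrix e f t = M2 ->
  represented_by S E.
Proof.
move=> EE SE sE tE; exists e, f; split=> // r; rewrite EE SE; split.
  case/mem_two_linesP => a [b ->]; by exists a, b; rewrite op_matrix_pencil sE tE.
case=> a [b rE]; apply/mem_two_linesP; exists a, b; apply: op_matrix_inj.
by rewrite rE op_matrix_pencil sE tE.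
Qed.
End Bases.

Lemma represented_by_pencil_inv m n S (E : 'M[K]_(m, n) -> Prop) M1 M2 :
  (forall M, E M <-> exists a b, M = a *: M1 + b *: M2) -> represented_by S E ->
  exists (e : n.-tuple U) (f : m.-tuple V) s t,
    [/\ basis_of fullv e, basis_of fullv f, S = (<[s]> + <[t]>)%VS,
        op_matrix e f s = M1 & op_matrix e f t = M2].
Proof.
move=> EE [e [f [be bf SE]]].
have [s sE] := op_matrix_surj be bf M1; have [t tE] := op_matrix_surj be bf M2.
exists e, f, s, t; split=> //; apply/vspaceP => r; apply/idP/mem_two_linesP.
  move=> /SE/EE[a [b rE]]; exists a, b; apply: (op_matrix_inj be bf).
  by rewrite rE op_matrix_pencil sE tE.
case=> a [b ->]; apply/SE/EE; by exists a, b; rewrite op_matrix_pencil sE tE.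
Qed.

Lemma E2_pencil M : E2 M <-> exists a b : K,
  M = a *: mx_of_rows 2 3 [:: [:: 1; 0; 0]; [:: 0; 1; 0]]
    + b *: mx_of_rows 2 3 [:: [:: 0; 1; 0]; [:: 0; 0; 1]].
Proof.
split=> -[a [b ->]]; exists a, b;
  apply/matrixP => -[[|[|?]] // ?] [[|[|[|?]]] // ?];
by rewrite !mxE /= ?(mulr0, mulr1, addr0, add0r).
Qed.

Lemma E3_pencil M : E3 M <-> exists a b : K,
  M = a *: mx_of_rows 3 3 [:: [:: 1; 0; 0]; [:: 0; 1; 0]; [:: 0; 0; 1]]
    + b *: mx_of_rows 3 3 [:: [:: 0; 1; 0]; [:: 0; 0; 1]; [:: 0; 0; 0]].
Proof.
split=> -[a [b ->]]; exists a, b;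
  apply/matrixP => -[[|[|[|?]]] // ?] [[|[|[|?]]] // ?];
by rewrite !mxE /= ?(mulr0, mulr1, addr0, add0r).
Qed.

Lemma E2T_pencil M : E2T M <-> exists a b : K,
  M = a *: mx_of_rows 3 2 [:: [:: 1; 0]; [:: 0; 1]; [:: 0; 0]]
    + b *: mx_of_rows 3 2 [:: [:: 0; 0]; [:: 1; 0]; [:: 0; 1]].
Proof.
split=> [[N [a [b ->]] ->]|[a [b ->]]].
  exists a, b; apply/matrixP => -[[|[|[|?]]] // ?] [[|[|?]] // ?];
  by rewrite !mxE /= ?(mulr0, mulr1, addr0, add0r).
eexists; first by exists a, b; reflexivity.
apply/matrixP => -[[|[|[|?]]] // ?] [[|[|?]] // ?];
by rewrite !mxE /= ?(mulr0, mulr1, addr0, add0r).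
Qed.

Lemma basis_spanning (X : vectType K) n (e : n.-tuple X) :
  (n <= \dim {:X})%N -> <<e>>%VS = fullv -> basis_of fullv e.
Proof. by move=> le_n eE; rewrite basisEdim eE subvv size_tuple. Qed.

Lemma reduced_range_span S s t (e : seq U) (Y : {vspace V}) : reduced S ->
  S = (<[s]> + <[t]>)%VS -> <<e>>%VS = fullv ->
  all (fun x => (s x \in Y) && (t x \in Y)) e -> Y = fullv.
Proof.
move=> redS SE eU /allP stY; apply: (reduced_range redS) => r u.
rewrite SE => /mem_two_linesP[a [b ->]]; rewrite add_lfunE !scale_lfunE.
have image r' : {in e, forall x, r' x \in Y} -> r' u \in Y.
  move=> r'Y; have : (r' @: <<e>> <= Y)%VS.
    by rewrite limg_span; apply/span_subvP => _ /mapP[x xe ->]; apply: r'Y.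
  by rewrite eU => /subvP; apply; rewrite memv_img ?memvf.
by rewrite memvD // memvZ // image // => x /stY /andP[].
Qed.

Ltac op_values := let j := fresh "j" in
  apply/op_matrixP => //; case=> [[|[|[|j]]] // ?];
  rewrite !big_ord_recl big_ord0 !mxE /= ?(scale0r, scale1r, addr0, add0r) //.

(** In the three normal forms below the basis of V consists of images of the
    basis of U; those images span V because S is reduced, so a lower bound on
    dim V makes them independent. *)
Lemma E2_represented S s t e1 e2 e3 : reduced S -> S = (<[s]> + <[t]>)%VS ->
  \dim {:U} = 3%N -> <<[:: e1; e2; e3]>>%VS = fullv -> (2 <= \dim {:V})%N ->
  t e1 = 0 -> s e3 = 0 -> t e2 = s e1 -> t e3 = s e2 -> represented_by S (@E2 K).
Proof.
move=> redS SE dimU eU dimV te1 se3 te2 te3.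
pose e := [tuple e1; e2; e3]; pose f := [tuple s e1; s e2].
have be : basis_of fullv e by apply: basis_spanning; rewrite ?dimU.
have bf : basis_of fullv f.
  apply: basis_spanning => //; apply: (reduced_range_span redS SE eU).
  by rewrite /= ?te1 ?se3 ?te2 ?te3 ?mem0v !memv_span ?inE ?eqxx ?orbT.
apply: (represented_by_pencil be bf E2_pencil SE); op_values => //.
Qed.

Lemma E3_represented S s t e1 e2 e3 : reduced S -> S = (<[s]> + <[t]>)%VS ->
  \dim {:U} = 3%N -> <<[:: e1; e2; e3]>>%VS = fullv -> (3 <= \dim {:V})%N ->
  t e1 = 0 -> t e2 = s e1 -> t e3 = s e2 -> represented_by S (@E3 K).
Proof.
move=> redS SE dimU eU dimV te1 te2 te3.
pose e := [tuple e1; e2; e3]; pose f := [tuple s e1; s e2; s e3].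
have be : basis_of fullv e by apply: basis_spanning; rewrite ?dimU.
have bf : basis_of fullv f.
  apply: basis_spanning => //; apply: (reduced_range_span redS SE eU).
  by rewrite /= ?te1 ?te2 ?te3 ?mem0v !memv_span ?inE ?eqxx ?orbT.
apply: (represented_by_pencil be bf E3_pencil SE); op_values => //.
Qed.

Lemma E2T_represented S s t e1 e2 : reduced S -> S = (<[s]> + <[t]>)%VS ->
  \dim {:U} = 2%N -> <<[:: e1; e2]>>%VS = fullv -> (3 <= \dim {:V})%N ->
  t e1 = s e2 -> represented_by S (@E2T K).
Proof.
move=> redS SE dimU eU dimV te1.
pose e := [tuple e1; e2]; pose f := [tuple s e1; s e2; t e2].
have be : basis_of fullv e by apply: basis_spanning; rewrite ?dimU.
have bf : basis_of fullv f.
  apply: basis_spanning => //; apply: (reduced_range_span redS SE eU).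
  by rewrite /= ?te1 ?mem0v !memv_span ?inE ?eqxx ?orbT.
apply: (represented_by_pencil be bf E2T_pencil SE); op_values => //.
Qed.
End Representations.

(** * The field with two elements *)

Section Coverings.
Local Open Scope ring_scope.

Lemma card_bigcup_le (I T : finType) (B : I -> {set T}) :
  (#|\bigcup_i B i| <= \sum_i #|B i|)%N.
Proof.
elim/big_ind2: _ => [|m X n Y le_m le_n|//]; first by rewrite cards0.
by rewrite (leq_trans (leq_card_setU _ _)) // leq_add.
Qed.

(** With q elements in the field, subspaces of codimension at least 2 have at
    most |U| / q^2 points, and q^2 of them cannot cover U since they all
    contain 0. *)
Lemma finite_field_cover (F : finFieldType) (I : finType) (U : vectType F)
    (A : I -> {vspace U}) :
  (#|I| <= #|F| ^ 2)%N -> (forall x : U, exists i, x \in A i) ->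
  exists i, (\dim {:U} <= (\dim (A i)).+1)%N.
Proof.
set q := #|F| => leIq; case: U A => T cT A cov; set U := Vector.Pack cT.
have [i lei|noI] := pickP (fun i => (\dim {:U} <= (\dim (A i)).+1)%N).
  by exists i.
pose fU : finType := finvect_type U.
have cardX (X : {vspace U}) : #|[set x : fU | x \in X]| = (q ^ \dim X)%N.
  by rewrite -(@card_vspace F fU cT X) cardsE.
have cardU : #|fU| = (q ^ \dim {:U})%N.
  by rewrite -cardX; apply: eq_card => x; rewrite !inE memvf.
pose O : fU := (0 : U).
pose B i : {set fU} := [set x : fU | x \in A i] :\ O.
have cardB i : #|B i| = (q ^ \dim (A i) - 1)%N.
  by rewrite cardsDS ?cards1 ?cardX // finset.sub1set inE mem0v.
have subB : [set~ O] \subset \bigcup_i B i.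
  apply/fintype.subsetP => x; rewrite in_setC1 => x0; have [i xi] := cov x.
  by apply/finset.bigcupP; exists i => //; rewrite in_setD1 x0 inE.
have q1 : (1 < q)%N by exact: finNzRing_gt1.
(* the index type is inhabited, so that dim U is at least 2 *)
have [i0 _] := cov 0.
have := noI i0; rewrite /= leqNgt => /negbFE dimU.
have leB i : (#|B i| <= q ^ (\dim {:U} - 2) - 1)%N.
  rewrite cardB leq_sub2r // leq_pexp2l ?(ltnW q1) //.
  by have := noI i; rewrite /= leqNgt => /negbFE; lia.
have := leq_trans (subset_leq_card subB) (card_bigcup_le _).
rewrite cardsC1 cardU => /leq_trans.
move/(_ _ (leq_sum (P := xpredT) _ (fun i _ => leB i)));
  rewrite sum_nat_const => /leq_trans/(_ (leq_mul leIq (leqnn _))).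
rewrite mulnBr muln1 -expnD subnKC; last by lia.
have : (q ^ 2 <= q ^ \dim {:U})%N by rewrite leq_pexp2l ?(ltnW q1) //; lia.
have : (q ^ 1 < q ^ 2)%N by rewrite ltn_exp2l.
rewrite expn1; lia.
Qed.

Lemma two_element_cover (K : fieldType) (U : vectType K) (A : 'I_4 ->
  {vspace U}) :
  (forall a : K, a = 0 \/ a = 1) -> (forall x : U, exists i, x \in A i) ->
  exists i, (\dim {:U} <= (\dim (A i)).+1)%N.
Proof.
(* K is opened into its components so that the finite field built on its
   carrier has the same field structure by conversion *)
move=> K2 cov; pose K0 := K; destruct K as [T [*]].
have enumP : Finite.axiom [:: 0; 1 : K0].
  by move=> x; case: (K2 x) => -> /=; rewrite ?eqxx ?(oner_eq0, eq_sym 0 1).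
have boolK : cancel (fun x : K0 => x == 0) (fun b => if b then 0 else 1).
  by move=> x; case: (K2 x) => ->; rewrite ?eqxx ?oner_eq0.
pose countK : isCountable K0 := CanIsCountable boolK.
pose fK : finFieldType := HB.pack K0 countK (isFinite.Build K0 enumP).
have cardK : (#|'I_4| <= #|fK| ^ 2)%N by rewrite card_ord [#|fK|]cardT enumT
  unlock.
exact: (@finite_field_cover fK 'I_4 U A cardK cov).
Qed.
End Coverings.

Section TwoElementFields.
Variable K : fieldType.
Local Open Scope classical_set_scope.
Local Open Scope ring_scope.

Lemma has_two_elementsP : has_two_elements K <-> forall a : K, a = 0 \/ a = 1.
Proof.
split=> [|K2].
  case/eq_cardSP => x _ /eq_cardSP[y _];
    rewrite II0 card_eq0 => /eqP/seteqP[noz _].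
  have xy (a : K) : a = x \/ a = y.
    have [->|ax] := eqVneq a x; first by left.
    have [->|ay] := eqVneq a y; first by right.
    case: (noz a); split; first by split=> //; apply/eqP.
    exact/eqP.
  have n01 : (0 : K) <> 1 by apply/eqP; rewrite eq_sym oner_eq0.
  move=> a; case: (xy a) (xy 0) (xy 1) => Ea [] E0 [] E1;
  by first [left; congruence | right; congruence | case: n01; congruence].
apply/eq_cardSP; exists 0 => //; apply/eq_cardSP; exists 1.
  by split=> //= /eqP; rewrite oner_eq0.
rewrite II0 card_eq0; apply/eqP/seteqP; split=> // a [[_ a0] a1].
by case: (K2 a) => ?; [case: a0|case: a1].
Qed.

Lemma third_element : ~ has_two_elements K ->
  exists lam : K, lam != 0 /\ lam != 1.
Proof.
move=> notK2; have /existsNP[lam /not_orP[/eqP lam0 /eqP lam1]] :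
    ~ (forall a : K, a = 0 \/ a = 1) by move/has_two_elementsP.
by exists lam.
Qed.
End TwoElementFields.

Section TwoElements.
Local Open Scope ring_scope.
Variables (K : fieldType) (U V : vectType K).
Implicit Types (S : {vspace 'Hom(U, V)}) (r s t g : 'Hom(U, V)).

Lemma dim_le1_line (X : vectType K) (W : {vspace X}) :
  (\dim W <= 1)%N -> exists v, forall w, w \in W -> w \in <[v]>%VS.
Proof.
move=> dimW; have [W0|/existsNP[v /not_implyP[vW /eqP v0]]] :=
    pselect (forall w, w \in W -> w = 0).
  by exists 0 => w /W0 ->; rewrite mem0v.
exists v => w wW; suff -> : <[v]>%VS = W by [].
by apply/eqP; rewrite eqEdim -memvE vW dim_vline v0.
Qed.

Hypothesis K2 : forall a : K, a = 0 \/ a = 1.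

Lemma addvv (X : lmodType K) (x : X) : x + x = 0.
Proof.
have -> : x + x = (1 + 1 : K) *: x by rewrite scalerDl scale1r.
case: (K2 (1 + 1)) => [-> | /eqP]; first by rewrite scale0r.
by rewrite -subr_eq0 addrK oner_eq0.
Qed.

Lemma oppv (X : lmodType K) (x : X) : - x = x.
Proof. by apply/eqP; rewrite eq_sym -addr_eq0 addvv. Qed.

Lemma addvvK (X : lmodType K) (x y : X) : x + (x + y) = y.
Proof. by rewrite addrA addvv add0r. Qed.

Lemma addvKv (X : lmodType K) (x y : X) : y + x + x = y.
Proof. by rewrite -addrA addvv addr0. Qed.

Lemma addvKC (X : lmodType K) (x y : X) : x + y + x = y.
Proof. by rewrite [x + y]addrC addvKv. Qed.

Lemma mem_two_lines_F2 (X : vectType K) (s t r : X) : r \in (<[s]> + <[t]>)%VS ->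
  [\/ r = 0, r = s, r = t | r = s + t].
Proof.
case/mem_two_linesP => a [b ->]; case: (K2 a) => ->; case: (K2 b) => ->;
rewrite !(scale0r, scale1r, addr0, add0r);
by [apply: Or41|apply: Or42|apply: Or43|apply: Or44].
Qed.

Lemma mem_line_F2 (X : vectType K) (s r : X) : r \in <[s]>%VS -> r = 0 \/ r = s.
Proof.
by case/vlineP => a ->; case: (K2 a) => ->; rewrite ?scale0r ?scale1r;
  [left|right].
Qed.

(** Each u lies in the kernel of g - r for one of the four elements r of S, and a
    kernel of codimension at most 1 means rank at most 1. *)
Lemma closure_rank_le1_F2 S g : \dim S = 2%N -> in_reflexive_closure S g ->
  exists2 r, r \in S & exists v, forall u, (g - r) u \in <[v]>%VS.
Proof.
move=> dimS gR.
have [s sS s0] := pencil_neq0 dimS.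
have [t [tS _ SE]] := pencil_complete dimS sS s0.
pose rs := [tuple 0; s; t; s + t].
have rsS i : tnth rs i \in S.
  by have := mem_tnth i rs; rewrite !inE => /or4P[] /eqP -> //;
    rewrite ?mem0v ?memvD.
have cov u : exists i, u \in lker (g - tnth rs i).
  have [r rS gu] := gR u.
  have /tnthP[i rE] : r \in rs.
    by move: rS; rewrite SE !inE => /mem_two_lines_F2[] ->; rewrite eqxx ?orbT.
  by exists i; rewrite memv_ker add_lfunE opp_lfunE gu rE subrr.
have [i dimk] := two_element_cover K2 cov.
exists (tnth rs i) => //.
have [|v vE] := @dim_le1_line _ (limg (g - tnth rs i)).
  by have := limg_ker_dim (g - tnth rs i) fullv; rewrite capfv; move: dimk; lia.
by exists v => u; apply: vE; rewrite memv_img ?memvf.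
Qed.

(** In this section g = phi (x) v.  On the affine hyperplane phi = 1, a colour of
    u is an operator r of S with r u = v; every point has a colour. *)
Section Colours.
Variables (S : {vspace 'Hom(U, V)}) (g : 'Hom(U, V)) (v : V) (phi : 'Hom(U, K^o)).
Hypotheses (dimS : \dim S = 2%N) (redS : reduced S).
Hypotheses (gR : in_reflexive_closure S g) (gS : g \notin S).
Hypothesis gE : forall u, g u = (phi u : K) *: v.

Let v0 : v != 0 := rank1_vector_neq0 gS gE.

Lemma colour u : phi u = 1 -> exists r, [/\ r \in S, r != 0 & r u = v].
Proof.
move=> pu; have [r rS] := gR u; rewrite gE pu scale1r => rv.
exists r; split=> //; apply: contraNneq v0 => r0; by rewrite rv r0 zero_lfunE.
Qed.

Lemma colour_neq0 r u : r u = v -> r != 0.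
Proof. by move=> ru; apply: contraNneq v0 => r0; rewrite -ru r0 zero_lfunE. Qed.

(** An operator of S equal to v on the whole affine hyperplane would be g. *)
Lemma colour_not_constant r : r \in S -> exists2 u, phi u = 1 & r u != v.
Proof.
move=> rS; apply: contrapT => /forall2NP rv.
have {}rv u : phi u = 1 -> r u = v.
  by move=> pu; case: (rv u) => // /negP; rewrite negbK => /eqP.
case/negP: gS; suff -> : g = r by [].
have [e pe] := rank1_form_eq1 gS gE.
apply/lfunP => u; rewrite gE; case: (K2 (phi u)) => pu;
  last by rewrite pu scale1r rv.
rewrite pu scale0r.
have := rv (u + e); rewrite !linearD /= pu pe add0r (rv e) // => /(_ erefl)/eqP.
by rewrite -subr_eq0 addrK => /eqP ->.
Qed.

Lemma two_kernels r c u : r \in S -> c \in S -> r != 0 -> c != 0 -> c != r ->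
  r u = 0 -> c u = 0 -> u = 0.
Proof.
move=> rS cS r0 c0 cr ru cu.
have cr' : c \notin <[r]>%VS.
  by apply/negP => /mem_line_F2[] /eqP; rewrite ?(negbTE c0) ?(negbTE cr).
apply: (reduced_ker redS) => s; rewrite (pencil_eq dimS rS cS r0 cr').
by move=> /mem_two_lines_F2[] ->; rewrite ?add_lfunE ?zero_lfunE ?ru ?cu ?addr0.
Qed.

(** Take a point u that does not have colour r.  None of u, u + n1 and u + n2 has
    it, so two of these three points share one of the two remaining colours c,
    and their difference is killed by both r and c, hence is zero.  Since n1 and
    n2 are nonzero, the two points are u + n1 and u + n2. *)
Lemma kernel_unique r n1 n2 : r \in S -> r != 0 -> phi n1 = 0 -> phi n2 = 0 ->
  r n1 = 0 -> r n2 = 0 -> n1 != 0 -> n2 != 0 -> n1 = n2.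
Proof.
move=> rS r0 p1 p2 r1 r2 n10 n20; have [u pu ru] := colour_not_constant rS.
have [t [tS tr SE]] := pencil_complete dimS rS r0.
have col n : phi n = 0 -> r n = 0 ->
  exists2 c : 'Hom(U, V), c (u + n) = v & c = t \/ c = r + t.
  move=> pn rn; have [|c [cS c0 cv]] := @colour (u + n);
    first by rewrite linearD /= pu pn addr0.
  exists c => //; move: cS; rewrite SE => /mem_two_lines_F2[] cE;
    [ | | by left | by right].
    by rewrite cE eqxx in c0.
  by case/eqP: ru; rewrite -cv cE linearD /= rn addr0.
have same (c : 'Hom(U, V)) n n' : c = t \/ c = r + t -> c (u + n) = v ->
    c (u + n') = v -> r n = 0 -> r n' = 0 -> n = n'.
  move=> ctE cn cn' rn rn'; apply: subr0_eq.
  have cS : c \in S by case: ctE => ->; rewrite ?memvD.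
  have c0 := colour_neq0 cn.
  apply: (two_kernels rS cS r0 c0).
  - case: ctE => ->; first by apply: contraNneq tr => ->; rewrite memv_line.
    by apply: contraNneq tr => /eqP; rewrite -subr_eq0 addrC addKr => /eqP ->;
      rewrite mem0v.
  - by rewrite linearB /= rn rn' subrr.
  have : c (u + n) - c (u + n') = 0 by rewrite cn cn' subrr.
  by rewrite -linearB opprD addrACA subrr add0r.
have [c0 c0v c0t] := col 0 (linear0 _) (linear0 _).
have [c1 c1v c1t] := col n1 p1 r1; have [c2 c2v c2t] := col n2 p2 r2.
have s01 : c0 <> c1.
  move=> E; case/eqP: n10; apply: esym.
  by apply: (same c0) => //; rewrite ?linear0 // E.
have s02 : c0 <> c2.
  move=> E; case/eqP: n20; apply: esym.
  by apply: (same c0) => //; rewrite ?linear0 // E.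
apply: (same c1) => //.
by have -> : c1 = c2 by case: c0t c1t c2t => [] E0 [] E1 [] E2; congruence.
Qed.

Lemma form_kernel_notin (W : {vspace U}) : ((\dim W).+1 < \dim {:U})%N ->
  exists2 b, phi b = 0 & b \notin W.
Proof.
move=> dimW; have : ~~ (lker phi <= W)%VS.
  by apply/negP => /dimvS; have := dim_lker_form phi; lia.
by case/subvPn => b; rewrite memv_ker => /eqP pb bW; exists b.
Qed.

Lemma full_of_form e (W : {vspace U}) : phi e = 1 -> e \in W ->
  (forall h, phi h = 0 -> h \in W) -> W = fullv.
Proof.
move=> pe eW hW; apply/eqP; rewrite eqEsubv subvf; apply/subvP => u _.
rewrite -(subrK (phi u *: e) u); apply: memvD; last exact: memvZ.
apply: hW.
by rewrite linearB linearZ /= pe [_ *: 1]mulr1 subrr.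
Qed.

(** An affine plane in phi = 1 has four points and there are three colours. *)
Lemma repeated_colour : (3 <= \dim {:U})%N ->
  exists r u h, [/\ r \in S, phi u = 1, phi h = 0, h != 0 & r u = v /\ r h = 0].
Proof.
move=> dimU; have [e pe] := rank1_form_eq1 gS gE.
have [|a pa] := @form_kernel_notin 0; first by rewrite dimv0; lia.
rewrite memv0 => a0.
have [|b pb ba] := @form_kernel_notin <[a]>; first by rewrite dim_vline a0.
have b0 : b != 0 by apply: contraNneq ba => ->; rewrite mem0v.
have ab : a + b != 0.
  by apply: contraNneq ba => /addr0_eq; rewrite oppv => <-; rewrite memv_line.
have a_b : a != b by apply: contraNneq ba => <-; rewrite memv_line.
pose pts := [:: e; e + a; e + b; e + (a + b)].
have pts1 u : u \in pts -> phi u = 1.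
  by rewrite !inE => /or4P[] /eqP ->;
    rewrite ?linearD /= pe ?linearD /= ?pa ?pb ?addr0.
have uniq_pts : uniq pts.
  have eN x : (e == e + x) = (x == 0).
    by rewrite -[X in X == _]addr0 (inj_eq (addrI e)) eq_sym.
  rewrite /= !inE !eN !(inj_eq (addrI e)) !negb_or a0 b0 ab a_b /=.
  rewrite -[X in X == a + b]addr0 (inj_eq (addrI a)) eq_sym b0 /=.
  by rewrite [a + b]addrC -[X in X == b + a]addr0 (inj_eq (addrI b)) eq_sym a0.
have /boolp.choice[C CP] (u : U) : exists r : 'Hom(U, V), phi u = 1 ->
    [/\ r \in S, r != 0 & r u = v].
  have [pu|pu] := pselect (phi u = 1); last by exists 0.
  by have [r] := colour pu; exists r.
have [rS r0 re] := CP e pe.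
have [t [tS _ SE]] := pencil_complete dimS rS r0.
have : ~~ uniq [seq C u | u <- pts].
  apply/negP => /(@uniq_leq_size _ _ [:: C e; t; C e + t]).
  rewrite size_map => le43; have // : (4 <= 3)%N;
    apply: le43 => _ /mapP[u /pts1 pu ->].
  have [] := CP u pu; rewrite SE => /mem_two_lines_F2[] -> //; rewrite ?eqxx //;
  by rewrite !inE eqxx ?orbT.
case/(uniqPn 0) => i [j [ij jsz]]; rewrite size_map in jsz.
have isz := ltn_trans ij jsz.
rewrite !(nth_map 0) // => Cij.
have pi := pts1 _ (mem_nth 0 isz); have pj := pts1 _ (mem_nth 0 jsz).
have [riS ri0 rii] := CP _ pi; have [_ _] := CP _ pj; rewrite -Cij => rij.
exists (C pts`_i), pts`_i, (pts`_i - pts`_j); split=> //.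
- by rewrite linearB /= pi pj subrr.
- by rewrite subr_eq0 (nth_uniq 0 isz jsz uniq_pts) neq_ltn ij.
- by rewrite linearB /= rii rij subrr.
Qed.

(** The common normal form when dim U >= 3.  Let e and e + h1 have colour s.  By
    [kernel_unique] the points e + h with h outside {0, h1} do not have it, and
    e + h, e + h + h1 cannot share a colour, so one of them has colour t and the
    other s + t.  If the kernel of phi had a point h other than 0, h1, h2 and
    h1 + h2, three such pairs would give t two distinct nonzero kernel vectors
    in the kernel of phi. *)
Lemma colouring_plane : (3 <= \dim {:U})%N -> exists s t e h1 h2,
  [/\ S = (<[s]> + <[t]>)%VS, [/\ phi e = 1, phi h1 = 0 & phi h2 = 0],
      [/\ h1 != 0, h2 != 0 & h2 != h1],
      [/\ s e = v, s h1 = 0, t (e + h2) = v & t h1 = s h2 + v]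
    & forall h, phi h = 0 -> h \in [:: 0; h1; h2; h1 + h2]].
Proof.
move=> dimU; have [s [e [h1 [sS pe p1 h10 [se sh1]]]]] := repeated_colour dimU.
have s0 := colour_neq0 se.
have [|h2 p2 h21'] := @form_kernel_notin <[h1]>; first by rewrite dim_vline h10.
have h20 : h2 != 0 by apply: contraNneq h21' => ->; rewrite mem0v.
have h21 : h2 != h1 by apply: contraNneq h21' => ->; rewrite memv_line.
have nots (c : 'Hom(U, V)) h : phi h = 0 -> h != 0 -> h != h1 ->
  c (e + h) = v -> c != s.
  move=> ph h0 hh1 ch; apply: contraNneq hh1 => cs; apply/eqP.
  apply: (kernel_unique sS s0 ph p1 _ sh1 h0 h10).
  by move: ch; rewrite cs linearD /= se => /eqP;
    rewrite addrC -subr_eq0 addrK => /eqP.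
have pe2 h : phi h = 0 -> phi (e + h) = 1 by move=> ph;
  rewrite linearD /= pe ph addr0.
have [t [tS t0 te2]] := colour (pe2 _ p2).
have ts : t != s := nots t h2 p2 h20 h21 te2.
have tsv : t \notin <[s]>%VS by apply/negP => /mem_line_F2[] /eqP;
  rewrite ?(negbTE t0) ?(negbTE ts).
have SE := pencil_eq dimS sS tS s0 tsv.
have th1 : t h1 != 0.
  by apply: contraNneq h10 => th1; apply/eqP;
    exact: (two_kernels sS tS s0 t0 ts sh1 th1).
have colour_ts h : phi h = 0 -> h != 0 -> h != h1 ->
    t (e + h) = v \/ (s + t) (e + h) = v.
  move=> ph h0 hh1; have [c [cS c0 ch]] := colour (pe2 _ ph).
  move: cS; rewrite SE => /mem_two_lines_F2[] cE; rewrite cE in c0 ch.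
  - by rewrite eqxx in c0.
  - by have := nots s h ph h0 hh1 ch; rewrite eqxx.
  - by left.
  - by right.
have addh1 h : h != 0 -> h != h1 -> h + h1 != 0 /\ h + h1 != h1.
  move=> h0 hh1; split; first by rewrite addr_eq0 oppv.
  by rewrite -subr_eq0 addrK.
have pick_t h : phi h = 0 -> h != 0 -> h != h1 -> exists k,
    [/\ phi k = 0, t (e + k) = v & k = h \/ k = h + h1].
  move=> ph h0 hh1; have [h10' h11'] := addh1 h h0 hh1.
  have ph1 : phi (h + h1) = 0 by rewrite linearD /= ph p1 addr0.
  case: (colour_ts h ph h0 hh1) => E1; first by exists h; split=> //; left.
  case: (colour_ts _ ph1 h10' h11') => E2; first by exists (h + h1);
    split=> //; right.
  case/eqP: th1; move: E2; rewrite addrA linearD /= E1 add_lfunE sh1 add0r.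
  by move=> /eqP; rewrite -subr_eq0 addrC addKr => /eqP.
(* the point e + h2 + h1 has colour s + t, since t already colours e + h2 *)
have th1E : t h1 = s h2 + v.
  have [h10' h11'] := addh1 h2 h20 h21.
  have ph : phi (h2 + h1) = 0 by rewrite linearD /= p2 p1 addr0.
  case: (colour_ts _ ph h10' h11') => E.
    case/eqP: th1; move: E; rewrite addrA linearD /= te2.
    by move=> /eqP; rewrite -subr_eq0 addrC addKr => /eqP.
  move: E; rewrite add_lfunE addrA !(linearD _ _ h1) /= sh1 addr0 te2 linearD
    /= se.
  by rewrite addrACA addvv add0r => <-; rewrite addvvK.
exists s, t, e, h1, h2; split=> // h ph; apply/negPn/negP.
rewrite !inE !negb_or => /and4P[h0 hh1 hh2 hh12].
have hh20 : h + h2 != 0 by rewrite addr_eq0 oppv.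
have hh21 : h + h2 != h1.
  by apply: contraNneq hh12 => <-; rewrite addvKv.
have phh2 : phi (h + h2) = 0 by rewrite linearD /= ph p2 addr0.
have [k [pk tk kE]] := pick_t h ph h0 hh1.
have [k' [pk' tk' k'E]] := pick_t _ phh2 hh20 hh21.
have kert x : t (e + x) = v -> t (x + h2) = 0.
  move=> tx; have -> : x + h2 = (e + x) + (e + h2) by rewrite addrACA addvv add0r.
  by rewrite linearD /= tx te2 addvv.
have px x : phi x = 0 -> phi (x + h2) = 0 by move=> px;
  rewrite linearD /= px p2 addr0.
have k0 : k + h2 != 0.
  rewrite addr_eq0 oppv; case: kE => -> //.
  by apply: contraNneq hh12 => <-; rewrite [h1 + _]addrC addvKv.
have k'0 : k' + h2 != 0.
  case: k'E => ->; first by rewrite addvKv.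
  by rewrite addrAC addvKv addr_eq0 oppv.
have /addIr kk' :=
  kernel_unique tS t0 (px _ pk) (px _ pk') (kert _ tk) (kert _ tk') k0 k'0.
case: kE k'E => kE [] k'E; move: kk'; rewrite kE k'E => /eqP.
- by rewrite -{1}[h]addr0 (inj_eq (addrI h)) eq_sym (negbTE h20).
- rewrite -addrA -{1}[h]addr0 (inj_eq (addrI h)) eq_sym addr_eq0 oppv; exact/negP.
- by rewrite (inj_eq (addrI h)) eq_sym (negbTE h21).
- by rewrite -addrA (inj_eq (addrI h)) -{1}[h1]add0r (inj_eq (addIr h1)) eq_sym
  (negbTE h20).
Qed.

Lemma span3_full (X : vectType K) (x y z : X) (xs : seq X) :
  <<[:: x; y; z]>>%VS = fullv -> x \in <<xs>>%VS -> y \in <<xs>>%VS ->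
  z \in <<xs>>%VS -> <<xs>>%VS = fullv.
Proof.
move=> xyzE xX yX zX; apply/eqP; rewrite eqEsubv subvf -xyzE.
by apply/span_subvP => w; rewrite !inE => /or3P[] /eqP ->.
Qed.

Ltac in_span := by rewrite memv_span // !inE ?eqxx ?orbT.

(** In the notation of [colouring_plane], s e = v, s h1 = 0 and t h1 = s h2 + v,
    while v and s h2 are independent.  If dim V >= 3 the basis h1, e + h2, e
    gives E3.  Otherwise t h2 is one of the four vectors of <v, s h2>, and in
    each case t also has a kernel line; taking a vector e1 of that line, e3 = h1
    and the e2 with t e2 = s e1 and s e2 = t e3 gives E2. *)
Lemma represented_E2_or_E3 : (3 <= \dim {:U})%N -> (2 <= \dim {:V})%N ->
  represented_by S (@E2 K) \/ represented_by S (@E3 K).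
Proof.
move=> dimU dimV.
have [s [t [e [h1 [h2 []]]]]] := colouring_plane dimU.
move=> SE [pe p1 p2] [h10 h20 h21] [se sh1 te2 th1] kerE.
have spanU : <<[:: e; h1; h2]>>%VS = fullv.
  apply: (@full_of_form e) => // [|h /kerE];
    first by rewrite memv_span ?inE ?eqxx.
  rewrite !inE => /or4P[] /eqP ->;
    rewrite ?mem0v ?memvD ?memv_span ?inE ?eqxx ?orbT //.
have dimU3 : \dim {:U} = 3%N.
  by apply/eqP; rewrite eqn_leq dimU andbT -spanU; have := dim_span [:: e; h1;
    h2].
have sS : s \in S by rewrite SE (subvP (addvSl _ _)) ?memv_line.
have tS : t \in S by rewrite SE (subvP (addvSr _ _)) ?memv_line.
have s0 := colour_neq0 se; have t0 := colour_neq0 te2.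
have ts : t != s.
  apply: contraNneq v0 => tsE; apply/eqP; move: th1; rewrite tsE sh1 => /esym/eqP.
  rewrite addr_eq0 oppv => /eqP sh2; move: te2;
    rewrite tsE linearD /= se sh2 addvv.
  by move=> <-.
have a0 : s h2 != 0.
  by apply: contraNneq h21 => sh2;
    rewrite (kernel_unique sS s0 p2 p1 sh2 sh1 h20 h10).
have av : s h2 != v.
  apply: contraNneq h10 => sh2; apply/eqP;
    apply: (two_kernels sS tS s0 t0 ts sh1).
  by rewrite th1 sh2 addvv.
have [dimV3|dimV2] := leqP 3 (\dim {:V}).
  right; apply: (@E3_represented _ _ _ _ t s h1 (e + h2) e redS) => //.
  - by rewrite addvC.
  - apply: (span3_full spanU); [in_span|in_span|].
    by rewrite -[X in X \in _](addvvK e); apply: memvD; in_span.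
  - by rewrite linearD /= se th1 addrC.
  - by rewrite se te2.
left.
have VE : (<[v]> + <[s h2]>)%VS = fullv.
  apply/eqP; rewrite eqEsubv subvf /=.
  have avl : s h2 \notin <[v]>%VS by apply/negP => /mem_line_F2[] /eqP;
    rewrite ?(negbTE a0) ?(negbTE av).
  have [f [h [_ _ _ _ fhE]]] := dual_pair v0 avl.
  by apply/subvP => z _; rewrite (fhE _ z) // memv_add // memvZ ?memv_line.
have te : t e = t h2 + v.
  by move: te2; rewrite linearD /= => <-; rewrite addrC addvKv.
have : t h2 \in fullv by exact: memvf.
rewrite -VE => /mem_two_lines_F2[] th2.
- apply: (@E2_represented _ _ _ _ s t h2 (e + h1 + h2) h1 redS) => //.
  + apply: (span3_full spanU); [|in_span|in_span].
    by rewrite -[X in X \in _](addvKv h1) -[X in X + _ \in _](addvKv h2);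
      apply: memvD; [apply: memvD; in_span|in_span].
  + by rewrite !linearD /= te th2 th1 add0r addr0 [s h2 + v]addrC addvvK.
  + by rewrite !linearD /= se sh1 addr0 th1 addrC.
- apply: (@E2_represented _ _ _ _ s t e (e + h2) h1 redS) => //.
  + apply: (span3_full spanU); [in_span|in_span|].
    by rewrite -[X in X \in _](addvvK e); apply: memvD; in_span.
  + by rewrite te th2 addvv.
  + by rewrite te2 se.
  + by rewrite linearD /= se th1 addrC.
- apply: (@E2_represented _ _ _ _ s t (e + h1) (e + h2) h1 redS) => //.
  + have eX : e \in <<[:: (e + h1)%R; (e + h2)%R; h1]>>%VS.
      by rewrite -[X in X \in _](addvKv h1); apply: memvD; in_span.
    apply: (span3_full spanU) => //; first by in_span.
    by rewrite -[X in X \in _](addvvK e); apply: memvD => //; in_span.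
  + by rewrite linearD /= te th2 th1 addvv.
  + by rewrite te2 linearD /= se sh1 addr0.
  + by rewrite linearD /= se th1 addrC.
- apply: (@E2_represented _ _ _ _ s t (h1 + h2) (e + h1 + h2) h1 redS) => //.
  + apply: (span3_full spanU); [|in_span|].
      by rewrite -[X in X \in _](addvKv (h1 + h2)); apply: memvD;
        [rewrite addrA|]; in_span.
    by rewrite -[X in X \in _](addvvK h1); apply: memvD; in_span.
  + by rewrite linearD /= th1 th2 addrC [v + _]addrC addvv.
  + by rewrite !linearD /= te th2 th1 sh1 add0r [s h2 + v]addrC addvKv addvKC.
  + by rewrite !linearD /= se sh1 addr0 th1 addrC.
Qed.

(** The affine line phi = 1 has two points e and e + h, of distinct colours s and
    t; then (t + s) e = v + t e = t h, which is the relation defining E2^T. *)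
Lemma represented_E2T : \dim {:U} = 2%N -> (3 <= \dim {:V})%N ->
  represented_by S (@E2T K).
Proof.
move=> dimU dimV; have [e pe] := rank1_form_eq1 gS gE.
have [|h ph] := @form_kernel_notin 0; first by rewrite dimv0 dimU.
rewrite memv0 => h0.
have he : e \notin <[h]>%VS.
  apply/negP => /vlineP[c eE]; move/eqP: pe.
  by rewrite eE linearZ /= ph scaler0 eq_sym oner_eq0.
have spanU : <<[:: e; h]>>%VS = fullv.
  apply/eqP; rewrite eqEdim subvf dimU.
  by have /eqP -> : free [:: e;
    h] by rewrite free_cons span_seq1 he /free span_seq1 dim_vline h0.
have [s [sS s0 se]] := colour pe.
have peh : phi (e + h) = 1 by rewrite linearD /= pe ph addr0.
have [t [tS t0 te]] := colour peh.
have tsN : t != s.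
  apply/eqP => tsE; have [u pu /eqP] := colour_not_constant sS; apply.
  have : u \in <<[:: e; h]>>%VS by rewrite spanU memvf.
  rewrite span_cons span_seq1 => /mem_two_lines_F2[] uE; move/eqP: pu; rewrite uE.
  - by rewrite linear0 eq_sym oner_eq0.
  - by rewrite se.
  - by rewrite ph eq_sym oner_eq0.
  - by rewrite -tsE te.
have ts : t \notin <[s]>%VS by apply/negP => /mem_line_F2[] /eqP;
  rewrite ?(negbTE t0) ?(negbTE tsN).
have st : (t + s) \notin <[t]>%VS.
  apply/negP => /mem_line_F2[] /eqP; first by rewrite addr_eq0 oppv (negbTE tsN).
  by rewrite -subr_eq0 addrC addKr (negbTE s0).
have SE := pencil_eq dimS tS (memvD tS sS) t0 st.
apply: (E2T_represented redS SE dimU spanU dimV).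
by rewrite add_lfunE se -te linearD addvvK.
Qed.

End Colours.

Lemma two_element_exception S g : \dim S = 2%N -> reduced S ->
  in_reflexive_closure S g -> g \notin S ->
  [\/ [/\ \dim {:U} = 2%N, \dim {:V} = 2%N & rank1_in_line S],
      represented_by S (@E2 K), represented_by S (@E3 K)
    | represented_by S (@E2T K)].
Proof.
move=> dimS redS gR gS.
have [r rS [v gv]] := closure_rank_le1_F2 dimS gR.
have gR' := closure_sub rS gR.
have gS' : g - r \notin S by apply: contraNN gS => gr; rewrite -(subrK r g) memvD.
have [phi phiE] := line_valued gv.
have dimU : (2 <= \dim {:U})%N.
  by rewrite ltnNge; apply: contraNN gS => /closure_domain_le1; apply.
have dimV : (2 <= \dim {:V})%N.
  by rewrite ltnNge; apply: contraNN gS => /(closure_codomain_le1 dimS); apply.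
have [dimU3|dimU2] := leqP 3 (\dim {:U}).
  by case: (represented_E2_or_E3 dimS redS gR' gS' phiE dimU3 dimV);
    [apply: Or42|apply: Or43].
have dimUE : \dim {:U} = 2%N by apply/eqP; rewrite eqn_leq dimU -ltnS dimU2.
have [dimV3|dimV2] := leqP 3 (\dim {:V}).
  by apply: Or44; apply: (represented_E2T dimS redS gR' gS' phiE).
apply: Or41; split=> //; last exact: closure_rank1_in_line gR gS.
by apply/eqP; rewrite eqn_leq dimV -ltnS dimV2.
Qed.

Lemma defect_eq1 S g : in_reflexive_closure S g -> g \notin S ->
  (forall h, in_reflexive_closure S h -> h \in (S + <[g]>)%VS) ->
  reflexivity_defect S = 1%N.
Proof.
move=> gR gS RE; rewrite /reflexivity_defect.
have -> : reflexive_closure S = (S + <[g]>)%VS.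
  apply/eqP; rewrite eqEsubv subv_add sub_reflexive_closure -memvE.
  apply/andP; split; last by apply/mem_reflexive_closure.
  by apply/subvP => h /mem_reflexive_closure/RE.
have g0 : g != 0 by apply: contraNneq gS => ->; rewrite mem0v.
have cap0 : (S :&: <[g]> = 0)%VS.
  apply/eqP; rewrite -subv0; apply/subvP => x; rewrite memv_cap memv0.
  by case/andP => xS /mem_line_F2[] xE; move: xS; rewrite xE ?eqxx ?(negbTE gS).
have := dimv_sum_cap S <[g]>; rewrite cap0 dimv0 dim_vline g0.
by rewrite addn0 => ->; rewrite addKn.
Qed.
End TwoElements.

(** * Reflexivity defects of the exceptional pencils *)

Section Defects.
Local Open Scope ring_scope.
Variables (K : fieldType) (U V : vectType K).
Implicit Types (S : {vspace 'Hom(U, V)}) (r s t g : 'Hom(U, V)).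

Hypothesis K2 : forall a : K, a = 0 \/ a = 1.

Let addKK (x y : K) : x + (x + y) = y := addvvK K2 (x : K^o) y.

Lemma coords2 (X : vectType K) (e : 2.-tuple X) u : basis_of fullv e ->
  exists x y, u = x *: e`_0 + y *: e`_1.
Proof.
move=> be; exists (coord e 0 u), (coord e 1 u).
rewrite [LHS](@coord_span _ _ _ e u) ?(span_basis be) ?memvf //.
rewrite !big_ord_recl big_ord0 addr0 /=.
by congr (coord e _ u *: _ + coord e _ u *: _); apply: val_inj.
Qed.

Lemma coords3 (X : vectType K) (e : 3.-tuple X) u : basis_of fullv e ->
  exists x y z, u = x *: e`_0 + y *: e`_1 + z *: e`_2.
Proof.
move=> be; exists (coord e 0 u), (coord e 1 u), (coord e 2 u).
rewrite [LHS](@coord_span _ _ _ e u) ?(span_basis be) ?memvf //.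
rewrite !big_ord_recl big_ord0 addr0 addrA /=.
by congr (coord e _ u *: _ + coord e _ u *: _ + coord e _ u *: _); apply: val_inj.
Qed.

Lemma coord_basis n (X : vectType K) (f : n.-tuple X) (i j : 'I_n) :
  basis_of fullv f -> coord f i f`_j = (j == i)%:R.
Proof. by move=> bf; rewrite coord_free ?(basis_free bf). Qed.

Lemma mem_pencil_line S s t g h a b c : S = (<[s]> + <[t]>)%VS ->
  h = a *: s + b *: t + c *: g -> h \in (S + <[g]>)%VS.
Proof.
move=> -> ->; rewrite memv_add ?memvZ ?memv_line //.
by apply/mem_two_linesP; exists a, b.
Qed.

Ltac matrix_value E bf j :=
  by have := proj1 (op_matrixP _ bf _ _) E j;
  rewrite !big_ord_recl big_ord0 !mxE /= ?(scale0r, scale1r, addr0, add0r).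

Lemma E2_values S : represented_by S (@E2 K) ->
  exists (e : 3.-tuple U) (f : 2.-tuple V) s t,
    [/\ basis_of fullv e, basis_of fullv f, S = (<[s]> + <[t]>)%VS,
        [/\ s e`_0 = f`_0, s e`_1 = f`_1 & s e`_2 = 0]
      & [/\ t e`_0 = 0, t e`_1 = f`_0 & t e`_2 = f`_1]].
Proof.
case/(represented_by_pencil_inv (@E2_pencil K)) => e [f [s [t [be bf SE sE tE]]]].
exists e, f, s, t; split=> //; split;
  [matrix_value sE bf (0 : 'I_3)|matrix_value sE bf (1 : 'I_3)|matrix_value sE
    bf (2 : 'I_3)
  |matrix_value tE bf (0 : 'I_3)|matrix_value tE bf (1 : 'I_3)|matrix_value tE
    bf (2 : 'I_3)].
Qed.

Lemma E3_values S : represented_by S (@E3 K) ->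
  exists (e : 3.-tuple U) (f : 3.-tuple V) s t,
    [/\ basis_of fullv e, basis_of fullv f, S = (<[s]> + <[t]>)%VS,
        [/\ s e`_0 = f`_0, s e`_1 = f`_1 & s e`_2 = f`_2]
      & [/\ t e`_0 = 0, t e`_1 = f`_0 & t e`_2 = f`_1]].
Proof.
case/(represented_by_pencil_inv (@E3_pencil K)) => e [f [s [t [be bf SE sE tE]]]].
exists e, f, s, t; split=> //; split;
  [matrix_value sE bf (0 : 'I_3)|matrix_value sE bf (1 : 'I_3)|matrix_value sE
    bf (2 : 'I_3)
  |matrix_value tE bf (0 : 'I_3)|matrix_value tE bf (1 : 'I_3)|matrix_value tE
    bf (2 : 'I_3)].
Qed.

Lemma E2T_values S : represented_by S (@E2T K) ->
  exists (e : 2.-tuple U) (f : 3.-tuple V) s t,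
    [/\ basis_of fullv e, basis_of fullv f, S = (<[s]> + <[t]>)%VS,
        s e`_0 = f`_0 /\ s e`_1 = f`_1 & t e`_0 = f`_1 /\ t e`_1 = f`_2].
Proof.
case/(represented_by_pencil_inv (@E2T_pencil K)) => e [f [s [t [be bf SE sE
  tE]]]].
exists e, f, s, t; split=> //; split;
  [matrix_value sE bf (0 : 'I_2)|matrix_value sE bf (1 : 'I_2)
  |matrix_value tE bf (0 : 'I_2)|matrix_value tE bf (1 : 'I_2)].
Qed.

(** The extra operator maps the middle basis vector to f0 + f1 and the others to
    0.  The upper bound comes from the value at e0 + e1 + e2, where s and t
    agree. *)
Lemma E2_defect S : represented_by S (@E2 K) -> reflexivity_defect S = 1%N.
Proof.
case/E2_values => e [f [s [t [be bf SE [s0 s1 s2] [t0 t1 t2]]]]].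
have [g gE] := lfun_on_basis [tuple 0; f`_0 + f`_1; 0] be.
have g0 : g e`_0 = 0 := gE 0; have g1 : g e`_1 = f`_0 + f`_1 := gE 1.
have g2 : g e`_2 = 0 := gE 2.
have c00 : coord f 0 f`_0 = 1 := coord_basis 0 0 bf.
have c01 : coord f 0 f`_1 = 0 := coord_basis 0 1 bf.
have c10 : coord f 1 f`_0 = 0 := coord_basis 1 0 bf.
have c11 : coord f 1 f`_1 = 1 := coord_basis 1 1 bf.
have sc := (scale0r, scale1r, scaler0, addr0, add0r).
have mc := (mulr0, mulr1, addr0, add0r).
have image (a b : K) u : (a *: s + b *: t) u = a *: s u + b *: t u.
  by rewrite add_lfunE !scale_lfunE.
apply: (@defect_eq1 _ _ _ K2 _ g).
- apply: (combination_closure SE) => u; have [x [y [z ->]]] := coords3 u be.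
  rewrite !linearD !linearZ /= s0 s1 s2 t0 t1 t2 g0 g1 g2.
  case: (K2 x) (K2 y) (K2 z) => -> [] -> [] ->; rewrite ?sc;
  by [exists 0, 0; rewrite ?sc | exists 1, 0; rewrite ?sc
    | exists 0, 1; rewrite ?sc | exists 1, 1; rewrite ?sc 1?addrC].
- rewrite SE; apply/mem_two_linesP => -[a [b gab]].
  move: (congr1 (coord f 1) g1);
    rewrite gab image s1 t1 !linearD !linearZ /= c10 c11 !mc.
  move: (congr1 (coord f 0) g0);
    rewrite gab image s0 t0 !linearD !linearZ /= !linear0 c00 !mc.
  by move=> -> /eqP; rewrite eq_sym oner_eq0.
- move=> h hR.
  have [a0 [b0]] := closure_combination SE hR e`_0;
    rewrite s0 t0 scaler0 addr0 => h0.
  have [a1 [b1]] := closure_combination SE hR e`_1; rewrite s1 t1 => h1.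
  have [a2 [b2]] := closure_combination SE hR e`_2;
    rewrite s2 t2 scaler0 add0r => h2.
  have [k [l]] := closure_combination SE hR (e`_0 + e`_1 + e`_2).
  rewrite !linearD /= h0 h1 h2 s0 s1 s2 t0 t1 t2 !sc => E.
  have E0 : a0 + b1 = k + l.
    by move: (congr1 (coord f 0) E); rewrite !(linearD, linearZ) /= c00 c01 !mc.
  have E1 : a1 + b2 = k + l.
    by move: (congr1 (coord f 1) E); rewrite !(linearD, linearZ) /= c10 c11 !mc.
  apply: (@mem_pencil_line _ s t g h a0 b2 (a0 + a1)) => //.
  apply: (lfun_eq_basis be) => -[[|[|[|j]]] // ?] /=;
  rewrite !(add_lfunE, scale_lfunE).
  + by rewrite h0 s0 t0 g0 !sc.
  + have b1E : b1 = b2 + (a0 + a1) by rewrite -(addKK a0 b1) E0 -E1; ring.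
    rewrite h1 b1E s1 t1 g1 -{1}(addKK a0 a1); move: (a0 + a1) => c.
    by rewrite !scalerDl [f`_0 + _]addrC scalerDr addrACA.
  + by rewrite h2 s2 t2 g2 !sc.
Qed.

(** The extra operator maps e1 and e2 to f1 and e0 to 0.  The upper bound comes
    from the values at e0 + e2 and e1 + e2. *)
Lemma E3_defect S : represented_by S (@E3 K) -> reflexivity_defect S = 1%N.
Proof.
case/E3_values => e [f [s [t [be bf SE [s0 s1 s2] [t0 t1 t2]]]]].
have [g gE] := lfun_on_basis [tuple 0; f`_1; f`_1] be.
have g0 : g e`_0 = 0 := gE 0; have g1 : g e`_1 = f`_1 := gE 1.
have g2 : g e`_2 = f`_1 := gE 2.
have c00 : coord f 0 f`_0 = 1 := coord_basis 0 0 bf.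
have c01 : coord f 0 f`_1 = 0 := coord_basis 0 1 bf.
have c02 : coord f 0 f`_2 = 0 := coord_basis 0 2 bf.
have c10 : coord f 1 f`_0 = 0 := coord_basis 1 0 bf.
have c11 : coord f 1 f`_1 = 1 := coord_basis 1 1 bf.
have c12 : coord f 1 f`_2 = 0 := coord_basis 1 2 bf.
have c20 : coord f 2 f`_0 = 0 := coord_basis 2 0 bf.
have c21 : coord f 2 f`_1 = 0 := coord_basis 2 1 bf.
have c22 : coord f 2 f`_2 = 1 := coord_basis 2 2 bf.
have sc := (scale0r, scale1r, scaler0, addr0, add0r).
have mc := (mulr0, mulr1, addr0, add0r).
have image (a b : K) u : (a *: s + b *: t) u = a *: s u + b *: t u.
  by rewrite add_lfunE !scale_lfunE.
apply: (@defect_eq1 _ _ _ K2 _ g).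
- apply: (combination_closure SE) => u; have [x [y [z ->]]] := coords3 u be.
  rewrite !linearD !linearZ /= s0 s1 s2 t0 t1 t2 g0 g1 g2.
  case: (K2 x) (K2 y) (K2 z) => -> [] -> [] ->; rewrite ?sc ?(addvv K2);
  by [exists 0, 0; rewrite ?sc | exists 1, 0; rewrite ?sc
    | exists 0, 1; rewrite ?sc | exists 1, 1; rewrite ?sc 1?(addvKC K2)].
- rewrite SE; apply/mem_two_linesP => -[a [b gab]].
  move: (congr1 (coord f 1) g1);
    rewrite gab image s1 t1 !linearD !linearZ /= c10 c11 !mc.
  move: (congr1 (coord f 0) g0);
    rewrite gab image s0 t0 !linearD !linearZ /= !linear0 c00 !mc.
  by move=> -> /eqP; rewrite eq_sym oner_eq0.
- move=> h hR.
  have [a0 [b0]] := closure_combination SE hR e`_0;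
    rewrite s0 t0 scaler0 addr0 => h0.
  have [a1 [b1]] := closure_combination SE hR e`_1; rewrite s1 t1 => h1.
  have [a2 [b2]] := closure_combination SE hR e`_2; rewrite s2 t2 => h2.
  have [k [l]] := closure_combination SE hR (e`_0 + e`_2).
  rewrite !linearD /= h0 h2 s0 s2 t0 t2 !sc => E.
  have a0k : a0 = k.
    by move: (congr1 (coord f 0) E);
      rewrite !(linearD, linearZ) /= c00 c01 c02 !mc.
  have a2k : a2 = k.
    by move: (congr1 (coord f 2) E);
      rewrite !(linearD, linearZ) /= c20 c21 c22 !mc.
  have [k' [l']] := closure_combination SE hR (e`_1 + e`_2).
  rewrite !linearD /= h1 h2 s1 s2 t1 t2 => E'.
  have b1l : b1 = l'.
    by move: (congr1 (coord f 0) E');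
      rewrite !(linearD, linearZ) /= c00 c01 c02 !mc.
  have a2k' : a2 = k'.
    by move: (congr1 (coord f 2) E');
      rewrite !(linearD, linearZ) /= c20 c21 c22 !mc.
  have E1 : a1 + b2 = a0 + b1.
    move: (congr1 (coord f 1) E');
      rewrite !(linearD, linearZ) /= c10 c11 c12 !mc => ->.
    by rewrite b1l a0k -a2k a2k'.
  apply: (@mem_pencil_line _ s t g h a0 b1 (a0 + a1)) => //.
  apply: (lfun_eq_basis be) => -[[|[|[|j]]] // ?] /=;
  rewrite !(add_lfunE, scale_lfunE).
  + by rewrite h0 s0 t0 g0 !sc.
  + rewrite h1 s1 t1 g1 -{1}(addKK a0 a1); move: (a0 + a1) => c.
    by rewrite scalerDl addrAC.
  + have b2E : b2 = b1 + (a0 + a1) by rewrite -(addKK a1 b2) E1; ring.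
    by rewrite h2 b2E s2 t2 g2 a2k a0k scalerDl addrA.
Qed.

(** The extra operator maps e1 to f1 + f2 and e0 to 0.  The upper bound comes from
    the value at e0 + e1. *)
Lemma E2T_defect S : represented_by S (@E2T K) -> reflexivity_defect S = 1%N.
Proof.
case/E2T_values => e [f [s [t [be bf SE [s0 s1] [t0 t1]]]]].
have [g gE] := lfun_on_basis [tuple 0; f`_1 + f`_2] be.
have g0 : g e`_0 = 0 := gE 0; have g1 : g e`_1 = f`_1 + f`_2 := gE 1.
have c00 : coord f 0 f`_0 = 1 := coord_basis 0 0 bf.
have c01 : coord f 0 f`_1 = 0 := coord_basis 0 1 bf.
have c02 : coord f 0 f`_2 = 0 := coord_basis 0 2 bf.
have c10 : coord f 1 f`_0 = 0 := coord_basis 1 0 bf.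
have c11 : coord f 1 f`_1 = 1 := coord_basis 1 1 bf.
have c12 : coord f 1 f`_2 = 0 := coord_basis 1 2 bf.
have c20 : coord f 2 f`_0 = 0 := coord_basis 2 0 bf.
have c21 : coord f 2 f`_1 = 0 := coord_basis 2 1 bf.
have c22 : coord f 2 f`_2 = 1 := coord_basis 2 2 bf.
have sc := (scale0r, scale1r, scaler0, addr0, add0r).
have mc := (mulr0, mulr1, addr0, add0r).
have image (a b : K) u : (a *: s + b *: t) u = a *: s u + b *: t u.
  by rewrite add_lfunE !scale_lfunE.
apply: (@defect_eq1 _ _ _ K2 _ g).
- apply: (combination_closure SE) => u; have [x [y ->]] := coords2 u be.
  rewrite !linearD !linearZ /= s0 s1 t0 t1 g0 g1.
  case: (K2 x) (K2 y) => -> [] ->; rewrite ?sc;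
  by [exists 0, 0; rewrite ?sc | exists 1, 0; rewrite ?sc
    | exists 0, 1; rewrite ?sc | exists 1, 1; rewrite ?sc].
- rewrite SE; apply/mem_two_linesP => -[a [b gab]].
  move: (congr1 (coord f 1) g1);
    rewrite gab image s1 t1 !linearD !linearZ /= c11 c12 !mc.
  move: (congr1 (coord f 0) g0);
    rewrite gab image s0 t0 !linearD !linearZ /= !linear0 c00 c01 !mc.
  by move=> -> /eqP; rewrite eq_sym oner_eq0.
- move=> h hR.
  have [a0 [b0]] := closure_combination SE hR e`_0; rewrite s0 t0 => h0.
  have [a1 [b1]] := closure_combination SE hR e`_1; rewrite s1 t1 => h1.
  have [k [l]] := closure_combination SE hR (e`_0 + e`_1).
  rewrite !linearD /= h0 h1 s0 s1 t0 t1 => E.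
  have a0k : a0 = k.
    by move: (congr1 (coord f 0) E);
      rewrite !(linearD, linearZ) /= c00 c01 c02 !mc.
  have b1l : b1 = l.
    by move: (congr1 (coord f 2) E);
      rewrite !(linearD, linearZ) /= c20 c21 c22 !mc.
  have E1 : b0 + a1 = a0 + b1.
    by move: (congr1 (coord f 1) E);
      rewrite !(linearD, linearZ) /= c10 c11 c12 !mc a0k b1l.
  apply: (@mem_pencil_line _ s t g h a0 b0 (a0 + a1)) => //.
  apply: (lfun_eq_basis be) => -[[|[|j]] // ?] /=;
  rewrite !(add_lfunE, scale_lfunE).
  + by rewrite h0 s0 t0 g0 !sc.
  + have b1E : b1 = b0 + (a0 + a1) by rewrite -(addKK a0 b1) -E1; ring.
    rewrite h1 b1E s1 t1 g1 -{1}(addKK a0 a1); move: (a0 + a1) => c.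
    by rewrite !scalerDl scalerDr addrACA.
Qed.
End Defects.

(** * Reflexive pencils *)

Theorem theorem6p1 (K : fieldType) (U V : vectType K)
    (S : {vspace 'Hom(U, V)}) (dimS : \dim S = 2) (redS : reduced S) :
  (~ [\/ [/\ \dim {:U} = 2, \dim {:V} = 2 & rank1_in_line S],
         represented_by S (@E2 K) /\ has_two_elements K,
         represented_by S (@E3 K) /\ has_two_elements K
       | represented_by S (@E2T K) /\ has_two_elements K] ->
   algebraically_reflexive S) /\
  ([\/ represented_by S (@E2 K) /\ has_two_elements K,
       represented_by S (@E3 K) /\ has_two_elements K
     | represented_by S (@E2T K) /\ has_two_elements K] ->
   reflexivity_defect S = 1).
Proof.
split; last first.
  by case=> -[repS /has_two_elementsP K2];
    [apply: E2_defect repS | apply: E3_defect repS | apply: E2T_defect repS].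
move=> notexc; apply/eqP; rewrite eqEsubv sub_reflexive_closure andbT.
apply/subvP => g /mem_reflexive_closure gR; apply/negPn/negP => gS; apply: notexc.
have [two|/third_element[lam [lam0 lam1]]] := pselect (has_two_elements K).
  have K2 := proj1 (has_two_elementsP K) two.
  by case: (two_element_exception K2 dimS redS gR gS) => ?;
    [apply: Or41 | apply: Or42 | apply: Or43 | apply: Or44].
exact/Or41/(large_field_exception lam0 lam1 dimS redS gR gS).
Qed.
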